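(* Fix $\beta \in \mathbb{R}_{>0}$, and let $\omega$ be the random permutation of $\{1,\dots,N\}$ distributed according to the Mallows measure $\mathcal{M}_{N}^{q}$, where $q=1-\beta/N$ and $N \in \mathbb{N}$. Let $A_N$ be a non-decreasing sequence of real numbers such that $\lim_{N\to\infty}A_N/N^{1/6}=0$. Then, for any $0 < x, y <1$, as $N\to\infty$, $$\max_{|k-h_{\beta}(x, y) N| < \sqrt{N} \cdot A_N}\left| \frac{\sigma_{N, \beta}(x,y)\, \mathcal{M}_{N}^{q}\left( H_{\lfloor x N\rfloor, \lfloor y N\rfloor}(\omega)= k \right)}{\mathcal{N}\left(\frac{k-h_{\beta}(x, y) N}{\sigma_{N, \beta}(x,y)}\right)} - 1\right|=O\left(\frac{A_N^3}{\sqrt{N}}\right),$$ where the maximum is over integers $k$.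
   Context: For $q\in[0,1)$, the Mallows measure $\mathcal{M}_N^q$ on permutations of $\{1,\dots,N\}$ assigns to a permutation $w$ the probability $q^{\mathrm{inv}(w)}Y_N$, where $\mathrm{inv}(w)$ is the number of inversions of $w$ and $Y_N=\prod_{j=1}^N\frac{1-q}{1-q^j}$. With $q=1-\beta/N$ one considers $N$ large enough that $q\in[0,1)$. $\mathcal{M}_N^q(E)$ denotes the probability of the event $E$. The height function of a permutation $\omega$ of size $N$ is $H_{L,K}(\omega) := \#\{ i : 1 \le i \le L,\ 1 \le \omega(i) \le K \}$, for integers $1\le L,K\le N$. $\mathcal{N}(t)=\frac{1}{\sqrt{2\pi}}e^{-t^2/2}$ is the density of the standard normal distribution. For $\beta>0$, $x,y\in(0,1)$: $$h_{\beta}(x, y)=\frac{1}{\beta}\left[\ln(1-e^{-\beta})-\ln(e^{-\beta x}+e^{-\beta y}-e^{-\beta(x+y)}-e^{-\beta})\right],$$ $$d_{\beta}(x,y)=\tfrac{1}{2}\ln(1- e^{-\beta})-\tfrac{1}{2}\ln(1- e^{- \beta(x-h_{\beta}(x, y))})-\tfrac{1}{2}\ln(1- e^{-\beta(y-h_{\beta}(x, y)) }),$$ $$\sigma_{N, \beta}(x,y)=\frac{\sqrt{N}}{\sqrt{\beta}\exp(d_{\beta}(x,y))}.$$ A maximum over an empty set of $k$ is taken to be $0$. The implied constant in $O(\cdot)$ may depend on $\beta,x,y$ and the sequence $(A_N)$. *)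

(* Defs.v *)
From HB Require Import structures.
From mathcomp Require Import all_boot all_order all_algebra all_fingroup.
From mathcomp Require Import all_classical all_reals all_analysis.
Set Implicit Arguments.
Unset Strict Implicit.
Unset Printing Implicit Defensive.
Import Order.TTheory GRing.Theory Num.Theory.
Import numFieldNormedType.Exports.
Local Open Scope ring_scope.

(* Permutations of {1, ..., N} are encoded as 'S_N, the permutations of
   'I_N = {0, ..., N-1}: the ordinal i stands for the integer i + 1. *)
Definition inversions (N : nat) (w : 'S_N) : nat :=
  #|[set p : 'I_N * 'I_N | (p.1 < p.2)%N && (w p.2 < w p.1)%N]%SET|.

(* With the shift by one, 1 <= i <= L and 1 <= w(i) <= K become strict. *)
Definition height (N L K : nat) (w : 'S_N) : nat :=
  #|[set i : 'I_N | (i < L)%N && (w i < K)%N]%SET|.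

Section Mallows.
Context {R : realType}.

Definition mallows_norm (N : nat) (q : R) : R :=
  \prod_(1 <= j < N.+1) ((1 - q) / (1 - q ^+ j)).

(* A probability on 'S_N only for 0 <= q < 1. *)
Definition mallows (N : nat) (q : R) (E : {set 'S_N}) : R :=
  \sum_(w in E) q ^+ inversions w * mallows_norm N q.

End Mallows.

Section LimitShape.
Context {R : realType}.
Implicit Types (b x y : R).

Definition hlim b x y : R :=
  b^-1 * (ln (1 - expR (- b))
          - ln (expR (- b * x) + expR (- b * y) - expR (- b * (x + y))
                - expR (- b))).

Definition dlim b x y : R :=
  2^-1 * ln (1 - expR (- b))
  - 2^-1 * ln (1 - expR (- b * (x - hlim b x y)))
  - 2^-1 * ln (1 - expR (- b * (y - hlim b x y))).

Definition sigma (N : nat) b x y : R :=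
  Num.sqrt N%:R / (Num.sqrt b * expR (dlim b x y)).

End LimitShape.

Local Open Scope classical_set_scope.

Definition window {R : realType} (c r : R) : set int :=
  [set k : int | `|k%:~R - c| < r].

(* Finiteness makes [\big[Num.max/0]_(k \in window c r) F k], for F >= 0, the
   genuine maximum of F on the window, equal to 0 when the window is empty. *)
Lemma finite_window (R : realType) (c r : R) : finite_set (window c r).
Proof.
pose m : int := Num.floor (c - r).
pose n : int := Num.floor (c + r).
apply: (@sub_finite_set _ _ [set m + (i%:Z) | i in `I_(`|n - m|.+1)%N]).
  move=> k; rewrite /window/= ltr_distl => /andP[h1 h2].
  have mk : m <= k.
    by rewrite -(ler_int R); apply: le_trans (ltW h1); exact: floor_le.
  have kn : k <= n by rewrite /n floor_ge_int ltW.
  exists `|k - m|%N.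
    rewrite /= ltnS -lez_nat !gez0_abs ?subr_ge0// ?lerD2r//.
    exact: le_trans kn.
  by rewrite gez0_abs ?subr_ge0// addrCA subrr addr0.
exact/finite_image/finite_II.
Qed.

(* Main.v *)
Require Import Defs.
From mathcomp Require Import all_boot all_order all_algebra all_fingroup.
From mathcomp Require Import all_classical all_reals all_analysis.
From mathcomp Require Import measurable_realfun.
From mathcomp Require Import ring lra zify.
Import Order.TTheory GRing.Theory Num.Theory.
Import numFieldNormedType.Exports.
Local Open Scope classical_set_scope.
Local Open Scope ring_scope.

(** The law of the height function is explicit.  Write k, K - k, L - k and
    N + k - L - K for the entries of the two by two contingency table of the
    permutation.  Removing the first letter of a permutation gives a recursion
    in L whose solution is the q-hypergeometric law ([height_gf_formula]), so
    that consecutive probabilities p k and p (k + 1) have the ratio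

      (1 - q^(K-k)) (1 - q^(L-k))
      / (q^(K+L-2k-1) (1 - q^(k+1)) (1 - q^(N+k-L-K+1))).

    This ratio decreases in k, so the law is unimodal
    ([height_law_unimodal]).  With q = 1 - beta/N, its logarithm is a smooth
    function of k/N up to O(1/N).  That function vanishes at h = hlim beta x y
    ([saddle_eq]) and has there the derivative - kappa, where
    kappa = beta exp(2 dlim beta x y) ([kappaE]); hence
      ln (p (k + 1)) - ln (p k) = - kappa (k - h N) / N + O(1/N + (k/N - h)^2)
    for k within a small multiple of N of h N ([height_law_expansion]).

    The local limit theorem follows from this expansion, unimodality and the
    fact that the probabilities sum to one ([local_limit]); no Stirling formula
    is needed.  Summing the expansion, with w = |k - h N| / sqrt N,
      p k = Q exp(- kappa w^2 / 2) exp(eps k),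
      |eps k| <= const (1 + w)^3 / sqrt N
    for some normalizing constant Q.  Summed over k, the Gaussian factor gives
    sqrt(2 pi N / kappa) + O(1), by comparison of a unimodal sum with the
    integral of a normal density ([gauss_sum_le], [gauss_sum_ge]); the factor
    exp(eps k) changes the sum by O(1), and the tails are negligible because
    p is unimodal.  Hence Q sqrt(2 pi N / kappa) = 1 + O(1 / sqrt N), and
    sqrt(N / kappa) is sigma ([sigmaE]).

    Finally, a nondecreasing sequence A is either nowhere positive, in which
    case every window is empty, or eventually bounded below by a positive
    constant, in which case (1 + w)^3 / sqrt N = O(A^3 / sqrt N) on the window,
    and A^3 <= sqrt N eventually. *)

(** * The law of the height function *)

(** A permutation of n + 1 letters is the value j of its first letter together
    with a permutation of the remaining letters. *)
Lemma sum_lift_perm (V : nmodType) (n : nat) (F : 'S_n.+1 -> V) :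
  \sum_w F w = \sum_(j < n.+1) \sum_(s : 'S_n) F (lift_perm ord0 j s).
Proof.
rewrite pair_big /=.
rewrite (reindex (fun js : 'I_n.+1 * 'S_n => lift_perm ord0 js.1 js.2)) //=.
apply: onW_bij; apply: inj_card_bij => [[j s] [j' s'] /= E|].
  have jj' : j = j' by rewrite -(lift_perm_id ord0 j s) E lift_perm_id.
  rewrite -jj' in E *; congr (_, _); apply/permP => i.
  by apply: (@lift_inj _ j); rewrite -!(lift_perm_lift ord0) E.
by rewrite card_prod !card_Sn card_ord factS.
Qed.

Lemma card_ord_lt (n m : nat) : (m <= n)%N ->
  #|[set i : 'I_n | (i < m)%N]%SET| = m.
Proof.
move=> mn; rewrite -[RHS]card_ord -cardsT.
have inj : injective (widen_ord mn) by move=> i k /(congr1 val) ?;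
  apply: val_inj.
rewrite -(card_imset _ inj).
congr #|pred_of_set _|; apply/setP => i; rewrite inE.
apply/idP/imsetP => [im|[k _ ->]]; last exact: (valP k).
by exists (Ordinal im) => //; apply: val_inj.
Qed.

Lemma card_perm_lt (n K : nat) (w : 'S_n) : (K <= n)%N ->
  #|[set i : 'I_n | (w i < K)%N]%SET| = K.
Proof.
move=> Kn; rewrite -[RHS](card_ord_lt _ _ Kn).
rewrite -[LHS](card_imset _ (@perm_inj _ w)).
congr #|pred_of_set _|; apply/setP => i; rewrite inE;
  apply/imsetP/idP => [[k]|iK].
  by rewrite inE => ? ->.
by exists (w^-1 i)%g; rewrite ?inE permKV.
Qed.

Lemma card_sum_bool (T : finType) (P : pred T) :
  #|[set i | P i]%SET| = (\sum_(i : T) P i)%N.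
Proof.
by rewrite -sum1dep_card big_mkcond; apply: eq_bigr => i _; case: (P i).
Qed.

Lemma inversionsE (n : nat) (w : 'S_n) :
  inversions w = (\sum_(a < n) \sum_(b < n) ((a < b) && (w b < w a)))%N.
Proof. by rewrite /inversions card_sum_bool pair_big. Qed.

Lemma inversions_lift (n : nat) (j : 'I_n.+1) (s : 'S_n) :
  inversions (lift_perm ord0 j s) = (j + inversions s)%N.
Proof.
rewrite !inversionsE big_ord_recl; congr addn.
  rewrite big_ord_recl ltnn /= add0n.
  rewrite -[RHS](card_perm_lt _ _ s (ltn_ord j : (j <= n)%N)) card_sum_bool.
  apply: eq_bigr => b _; rewrite lift_perm_lift lift_perm_id /=.
  by rewrite /bump; case: (leqP j (s b)) => /= H; lia.
apply: eq_bigr => a _; rewrite big_ord_recl /= add0n.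
apply: eq_bigr => b _; rewrite !lift_perm_lift /=; congr (nat_of_bool (_ && _)).
by rewrite /bump; case: (leqP j (s a)); case: (leqP j (s b)) => /= *; lia.
Qed.

Lemma heightE (n L K : nat) (w : 'S_n) :
  height L K w = (\sum_(i < n) ((i < L) && (w i < K)))%N.
Proof. by rewrite /height card_sum_bool. Qed.

Lemma height_lift (n L K : nat) (j : 'I_n.+1) (s : 'S_n) :
  height L.+1 K (lift_perm ord0 j s) = ((j < K) + height L (K - (j < K)) s)%N.
Proof.
rewrite !heightE big_ord_recl lift_perm_id /=; congr addn.
apply: eq_bigr => i _; rewrite lift_perm_lift /=; congr (nat_of_bool (_ && _)).
by rewrite /bump; case: (leqP j (s i)); case: (ltnP j K) => /= *; lia.
Qed.

Lemma height0 (n K : nat) (w : 'S_n) : height 0 K w = 0%N.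
Proof. by rewrite heightE big1. Qed.

Lemma height_leL (n L K : nat) (w : 'S_n) : (L <= n)%N -> (height L K w <= L)%N.
Proof.
move=> Ln; rewrite -[X in (_ <= X)%N](card_ord_lt _ _ Ln);
  apply: subset_leq_card.
by apply/fintype.subsetP => i; rewrite !inE => /andP[].
Qed.

Lemma height_leK (n L K : nat) (w : 'S_n) : (K <= n)%N -> (height L K w <= K)%N.
Proof.
move=> Kn; rewrite -[X in (_ <= X)%N](card_perm_lt _ _ w Kn);
  apply: subset_leq_card.
by apply/fintype.subsetP => i; rewrite !inE => /andP[].
Qed.

Lemma height_ge (n L K : nat) (w : 'S_n) :
  (L <= n)%N -> (K <= n)%N -> (L + K <= n + height L K w)%N.
Proof.
move=> Ln Kn; rewrite -{1}(card_ord_lt _ _ Ln) -{1}(card_perm_lt _ _ w Kn).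
rewrite -cardsUI leq_add //;
  first by rewrite -[X in (_ <= X)%N]card_ord max_card.
by apply: subset_leq_card; apply/fintype.subsetP => i; rewrite !inE.
Qed.

(** The q-analogue 1 + q + ... + q^(n-1) of the integer n. *)
Definition qint {R : comNzRingType} (q : R) (n : nat) : R := \sum_(i < n) q ^+ i.

(** The q-factorial, the product of the q-analogues of 1, ..., n. *)
Definition qfact {R : comNzRingType} (q : R) (n : nat) : R :=
  \prod_(i < n) qint q i.+1.

(** The generating function of inversions over the permutations of n letters
    whose height function at (L, K) is k. *)
Definition height_gf {R : comNzRingType} (q : R) (n L K k : nat) : R :=
  \sum_(w : 'S_n | height L K w == k) q ^+ inversions w.

Section GeneratingFunction.
Variables (R : comNzRingType) (q : R).

Lemma qfactS n : qfact q n.+1 = qint q n.+1 * qfact q n.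
Proof. by rewrite /qfact big_ord_recr mulrC. Qed.

Lemma qfact0 : qfact q 0 = 1.
Proof. by rewrite /qfact big_ord0. Qed.

Lemma qintD m n : qint q (m + n) = qint q m + q ^+ m * qint q n.
Proof.
rewrite /qint big_split_ord /= mulr_sumr; congr +%R.
by apply: eq_bigr => i _; rewrite exprD.
Qed.

Lemma qint0 : qint q 0 = 0.
Proof. by rewrite /qint big_ord0. Qed.

Lemma sum_inversions n : \sum_(w : 'S_n) q ^+ inversions w = qfact q n.
Proof.
elim: n => [|n IH].
  rewrite qfact0 (eq_bigr (fun=> 1)) ?sumr_const ?card_Sn// => w _.
  by rewrite inversionsE big_ord0 expr0.
rewrite sum_lift_perm qfactS -IH /qint mulr_suml; apply: eq_bigr => j _.
by rewrite mulr_sumr; apply: eq_bigr => s _; rewrite inversions_lift exprD.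
Qed.

(** Conditioning on the value j of the first letter: the two terms collect
    j < K and K <= j. *)
Lemma height_gf_rec n L K k : (K <= n.+1)%N ->
  height_gf q n.+1 L.+1 K k =
  (if k is k'.+1 then qint q K * height_gf q n L K.-1 k' else 0)
  + q ^+ K * qint q (n.+1 - K) * height_gf q n L K k.
Proof.
move=> Kn; rewrite /height_gf big_mkcond sum_lift_perm /=.
have -> (F : 'I_n.+1 -> R) : \sum_(j < n.+1) F j =
    \sum_(i < K) F (inord i) + \sum_(i < n.+1 - K) F (inord (K + i)).
  transitivity (\sum_(0 <= j < n.+1) F (inord j)).
    by rewrite big_mkord; apply: eq_bigr => j _; rewrite inord_val.
  rewrite (big_cat_nat (leq0n K) Kn) /= big_mkord.
  congr +%R; rewrite -{1}(add0n K) big_addn big_mkord.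
  by apply: eq_bigr => i _; rewrite addnC.
congr +%R.
  case: k => [|k].
    rewrite big1 // => i _; rewrite big1 // => s _.
    by rewrite height_lift inordK ?ltn_ord ?(leq_trans (ltn_ord i)).
  rewrite /qint mulr_suml; apply: eq_bigr => i _.
  rewrite mulr_sumr [RHS]big_mkcond /=; apply: eq_bigr => s _.
  rewrite height_lift inversions_lift inordK ?(leq_trans (ltn_ord i))//.
  by rewrite add1n eqSS exprD subn1; case: ifP.
rewrite -mulrA /qint [X in _ * X]mulr_suml mulr_sumr; apply: eq_bigr => i _.
rewrite !mulr_sumr [RHS]big_mkcond /=; apply: eq_bigr => s _.
have iK : (K + i < n.+1)%N by rewrite -ltn_subRL.
rewrite height_lift inversions_lift inordK // ltnNge leq_addr /= subn0 add0n.
by case: ifP => //; rewrite !exprD mulrA.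
Qed.

Lemma height_gf_eq0 n L K k : (L <= n)%N -> (K <= n)%N ->
  (L < k)%N || (K < k)%N || (n + k < L + K)%N -> height_gf q n L K k = 0.
Proof.
move=> Ln Kn H; rewrite /height_gf big_pred0 // => w; apply/eqP => E.
have := height_leL _ _ K w Ln; have := height_leK _ L _ w Kn.
by have := height_ge _ _ _ w Ln Kn; rewrite E; lia.
Qed.

(** With the contingency table a = k, b = K - k, c = L - k and
    d = n + k - L - K, the generating function is q^(b c) times the product of
    the q-factorials of the four margins divided by that of the four entries. *)
Lemma height_gf_formula a b c d :
  height_gf q (a + b + c + d) (a + c) (a + b) a
    * (qfact q a * qfact q b * qfact q c * qfact q d) =
  q ^+ (b * c) * (qfact q (a + b) * qfact q (c + d)
                  * qfact q (a + c) * qfact q (b + d)).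
Proof.
have [m] : exists m, m = (a + c)%N by eexists.
elim: m a c => [|m IH] a c Em.
  have [-> ->] : a = 0%N /\ c = 0%N by lia.
  rewrite muln0 expr0 !add0n !addn0 /height_gf.
  under eq_bigl => w do rewrite height0 eqxx.
  by rewrite sum_inversions !qfact0; ring.
rewrite (_ : a + b + c + d = (m + b + d).+1)%N -?Em; last by lia.
rewrite height_gf_rec; last by lia.
rewrite (_ : (m + b + d).+1 - (a + b) = c + d)%N; last by lia.
rewrite !mulrDl Em.
have -> : q ^+ (a + b) * qint q (c + d) * height_gf q (m + b + d) m (a + b) a
    * (qfact q a * qfact q b * qfact q c * qfact q d) =
    q ^+ (b * c) * (qfact q (a + b) * qfact q (c + d) * qfact q m
       * qfact q (b + d)) * (q ^+ a * qint q c).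
  (* The term of the recursion where a letter K <= j is removed from c. *)
  case: c Em => [|c] Em.
    case: d {IH} => [|d]; first by rewrite !qint0 !mulr0 !mul0r.
    by rewrite qint0 (height_gf_eq0 _ _ (a + b) a) ?(mulr0, mul0r)//; lia.
  have := IH a c; rewrite (_ : a + c = m)%N; last by lia.
  rewrite (_ : a + b + c + d = m + b + d)%N; last by lia.
  move=> /(_ erefl) E.
  rewrite (qfactS c) addSn (qfactS (c + d)) mulnS !exprD.
  rewrite [LHS](_ : _ = q ^+ a * q ^+ b * qint q (c + d).+1 * qint q c.+1 *
    (height_gf q (m + b + d) m (a + b) a
        * (qfact q a * qfact q b * qfact q c * qfact q d))); last by ring.
  by rewrite E; ring.
have -> : match a with 0%N => 0 | k'.+1 =>
     qint q (a + b) * height_gf q (m + b + d) m (a + b).-1 k' end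
    * (qfact q a * qfact q b * qfact q c * qfact q d) =
    q ^+ (b * c) * (qfact q (a + b) * qfact q (c + d) * qfact q m
       * qfact q (b + d)) * qint q a.
  (* The term where a letter j < K is removed from a. *)
  case: a Em => [|a] Em; first by rewrite qint0 mul0r mulr0.
  have := IH a c; rewrite (_ : a + c = m)%N; last by lia.
  rewrite (_ : a + b + c + d = m + b + d)%N; last by lia.
  move=> /(_ erefl) E.
  rewrite addSn /= !qfactS.
  rewrite [LHS](_ : _ = qint q (a + b).+1 * qint q a.+1 *
    (height_gf q (m + b + d) m (a + b) a
        * (qfact q a * qfact q b * qfact q c * qfact q d))); last by ring.
  by rewrite E; ring.
by rewrite -Em (qfactS m) Em qintD; ring.
Qed.

End GeneratingFunction.

(** The probability that the height function takes the value k. *)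
Definition height_law {R : realType} (q : R) (n L K k : nat) : R :=
  height_gf q n L K k * mallows_norm n q.

Section HeightLaw.
Variables (R : realType) (q : R).
Hypotheses (q0 : 0 < q) (q1 : q < 1).

Let geom n : qint q n * (1 - q) = 1 - q ^+ n.
Proof.
by rewrite -[1 in RHS](expr1n _ n) subrXX mulrC /qint; congr (_ * _);
  apply: eq_bigr => i _; rewrite expr1n mul1r.
Qed.

Let qint_gt0 n : 0 < qint q n.+1.
Proof.
rewrite /qint big_ord_recl expr0 ltr_pwDl// sumr_ge0// => i _.
by rewrite exprn_ge0 ?ltW.
Qed.

Let qfact_gt0 n : 0 < qfact q n.
Proof. by apply: prodr_gt0 => i _; exact: qint_gt0. Qed.

Lemma mallows_normE n : mallows_norm n q = (qfact q n)^-1.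
Proof.
rewrite /mallows_norm big_add1 /= big_mkord /qfact -prodfV.
apply: eq_bigr => i _; rewrite -geom invfM mulrA mulrAC divff ?mul1r//.
by rewrite subr_eq0 gt_eqF.
Qed.

Lemma mallows_height n L K k :
  mallows q [set w : 'S_n | (height L K w)%:Z == k%:Z]%SET = height_law q n L K k.
Proof.
rewrite /mallows /height_law /height_gf mulr_suml.
by apply: eq_bigl => w; rewrite inE.
Qed.

Lemma height_law_ge0 n L K k : 0 <= height_law q n L K k.
Proof.
apply: mulr_ge0; last by rewrite mallows_normE invr_ge0 ltW.
apply: sumr_ge0 => w _.
by rewrite exprn_ge0 ?ltW.
Qed.

Lemma height_law_eq0 n L K k : (L <= n)%N -> (K <= n)%N ->
  (L < k)%N || (K < k)%N || (n + k < L + K)%N -> height_law q n L K k = 0.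
Proof. by move=> Ln Kn H; rewrite /height_law height_gf_eq0 ?mul0r. Qed.

Lemma sum_height_law n L K : (L <= n)%N
  -> \sum_(k < n.+1) height_law q n L K k = 1.
Proof.
move=> Ln; rewrite /height_law /height_gf -mulr_suml.
have Hk (w : 'S_n) : (height L K w < n.+1)%N.
  by rewrite ltnS (leq_trans (height_leL _ _ _ _ Ln)).
transitivity ((\sum_(w : 'S_n) q ^+ inversions w) * mallows_norm n q).
  by congr (_ * _); rewrite [in RHS](partition_big (fun w => Ordinal (Hk w)) xpredT)//=.
by rewrite sum_inversions mallows_normE divff ?gt_eqF.
Qed.

Let height_law_formula a b c d :
  height_law q (a + b + c + d) (a + c) (a + b) a =
  q ^+ (b * c) * (qfact q (a + b) * qfact q (c + d)
                  * qfact q (a + c) * qfact q (b + d))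
  / (qfact q a * qfact q b * qfact q c * qfact q d) / qfact q (a + b + c + d).
Proof.
rewrite /height_law mallows_normE -height_gf_formula mulfK//.
by rewrite gt_eqF// !mulr_gt0.
Qed.

Lemma height_law_gt0 n L K k : (k <= L)%N -> (k <= K)%N -> (L <= n)%N ->
  (L + K <= n + k)%N -> 0 < height_law q n L K k.
Proof.
move=> kL kK Ln LKn.
have := height_law_formula k (K - k) (L - k) (n + k - L - K).
rewrite (_ : k + (K - k) + (L - k) + (n + k - L - K) = n)%N; last by lia.
rewrite !subnKC// => ->.
by rewrite !(divr_gt0, mulr_gt0, exprn_gt0, qfact_gt0).
Qed.

Lemma height_law_ratio n L K k : (k < L)%N -> (k < K)%N -> (L <= n)%N ->
  (L + K <= n + k)%N ->
  height_law q n L K k.+1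
    * ((1 - q ^+ k.+1) * (1 - q ^+ (n + k - L - K).+1) * q ^+ (L + K - k - k).-1)
  = height_law q n L K k * ((1 - q ^+ (K - k)) * (1 - q ^+ (L - k))).
Proof.
move=> kL kK Ln LKn.
set a := k; set b := (K - k).-1; set c := (L - k).-1;
  set d := (n + k - L - K)%N.
have E1 := height_law_formula a b.+1 c.+1 d.
have E2 := height_law_formula a.+1 b c d.+1.
rewrite (_ : a + b.+1 + c.+1 + d = n)%N in E1; last by rewrite /a /b /c /d; lia.
rewrite (_ : a.+1 + b + c + d.+1 = n)%N in E2; last by rewrite /a /b /c /d; lia.
rewrite !(addnS, addSn) in E1 E2.
rewrite (_ : (a + b).+1 = K) in E1 E2; last by rewrite /a /b; lia.
rewrite (_ : (a + c).+1 = L) in E1 E2; last by rewrite /a /c; lia.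
rewrite {}E1 {}E2 -/a.
rewrite (_ : K - a = b.+1)%N; last by rewrite /a /b; lia.
rewrite (_ : L - a = c.+1)%N; last by rewrite /a /c; lia.
rewrite (_ : (L + K - a - a).-1 = (b + c).+1)%N; last by rewrite /a /b /c; lia.
rewrite !qfactS -!geom mulSn mulnS !addSn !(exprS, exprD).
have qn0 m : qint q m.+1 != 0 by rewrite gt_eqF.
have fn0 m : qfact q m != 0 by rewrite gt_eqF.
by field; rewrite !qn0 !fn0.
Qed.

(** Once the law stops increasing at a point of its support, it decreases from
    there on. *)
Lemma height_law_unimodal n L K i k : (L <= n)%N -> (K <= n)%N ->
  0 < height_law q n L K i -> height_law q n L K i.+1 <= height_law q n L K i ->
  (i <= k)%N -> height_law q n L K k.+1 <= height_law q n L K k.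
Proof.
move=> Ln Kn pi pii ik; set p := height_law q n L K.
(* Past the right end min(L, K) of the support the law vanishes, so the
   induction records whether k is still in the support. *)
suff: p k.+1 <= p k /\ ((minn L K < k)%N \/ 0 < p k) by case.
elim: k ik => [|k IH] ik.
  by move: ik; rewrite leqn0 => /eqP i0; rewrite i0 in pi pii; split; [|right].
move: ik; rewrite leq_eqVlt => /predU1P[<-|/IH [H1 H2]]; first by split;
  [|right].
have [kb|kb] := ltnP (minn L K) k.+1.
  split; last by left.
  by rewrite /p [X in X <= _]height_law_eq0 ?height_law_ge0//; lia.
have kL : (k < L)%N by lia.
have kK : (k < K)%N by lia.
case: H2 => [|pk]; first by lia.
have lo : (L + K <= n + k)%N.
  rewrite leqNgt; apply/negP => H.
  by move: pk; rewrite /p height_law_eq0 ?ltxx// H !orbT.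
have pk1 : 0 < p k.+1 by apply: height_law_gt0 => //; lia.
split; last by right.
have [kb2|kb2] := eqVneq k.+1 (minn L K).
  by rewrite /p [X in X <= _]height_law_eq0 ?height_law_ge0//; lia.
have e1 := height_law_ratio _ _ _ _ kL kK Ln lo.
have e2 : _ = _ := @height_law_ratio n L K k.+1 _ _ Ln _.
have {}e2 := e2 ltac:(lia) ltac:(lia) ltac:(lia).
rewrite -/p in e1 e2.
have mono m m' : (m <= m')%N -> q ^+ m' <= q ^+ m.
  by move=> mm; rewrite ler_wiXn2l ?ltW.
have lt1 m : 0 <= 1 - q ^+ m by rewrite subr_ge0 exprn_ile1 ?ltW.
have H : (1 - q ^+ (K - k)) * (1 - q ^+ (L - k)) <=
    (1 - q ^+ k.+1) * (1 - q ^+ (n + k - L - K).+1) * q ^+ (L + K - k - k).-1.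
  rewrite -(ler_pM2l pk) -e1 ler_wpM2r//.
  by rewrite !mulr_ge0 ?exprn_ge0 ?(ltW q0).
have H' : (1 - q ^+ (K - k.+1)) * (1 - q ^+ (L - k.+1)) <=
    (1 - q ^+ k.+2) * (1 - q ^+ (n + k.+1 - L - K).+1) * q ^+ (L + K - k.+1 - k.+1).-1.
  apply: le_trans (le_trans H _).
    by apply: ler_pM => //; rewrite lerD2l lerN2 mono//; lia.
  apply: ler_pM; rewrite ?exprn_ge0 ?mulr_ge0 ?(ltW q0)//; last by apply: mono;
    lia.
  by apply: ler_pM => //; rewrite lerD2l lerN2 mono//; lia.
have X0 : 0 < (1 - q ^+ k.+2) * (1 - q ^+ (n + k.+1 - L - K).+1)
     * q ^+ (L + K - k.+1 - k.+1).-1.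
  by rewrite !mulr_gt0 ?exprn_gt0// subr_gt0 exprn_ilt1 ?ltW.
by rewrite -(ler_pM2r X0) e2; apply: ler_wpM2l => //; exact: ltW.
Qed.

End HeightLaw.

(** * Sums of Gaussian weights over the integers *)

Section GaussianSum.
Variables (R : realType) (m s : R).
Hypotheses (s0 : 0 < s).
Local Notation mu := lebesgue_measure.
Local Notation g := (normal_fun m s).
Local Notation pk := (normal_peak s).

Let sn0 : s != 0. Proof. by rewrite gt_eqF. Qed.

Let pk0 : 0 < pk. Proof. exact: normal_peak_gt0. Qed.

Let g_le1 u : g u <= 1.
Proof.
rewrite /normal_fun -[leRHS]expR0 ler_expR mulNr oppr_le0 mulr_ge0 ?sqr_ge0//.
by rewrite invr_ge0 mulrn_wge0 ?sqr_ge0.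
Qed.

Let g_mono u v : `|u - m| <= `|v - m| -> g v <= g u.
Proof.
move=> uv; rewrite /normal_fun ler_expR !mulNr lerN2 ler_wpM2r//.
  by rewrite invr_ge0 mulrn_wge0 ?sqr_ge0.
by rewrite -(real_normK (num_real (u - m))) -(real_normK (num_real (v - m))) lerXn2r ?nnegrE.
Qed.

Let pdfE u : normal_pdf m s u = pk * g u.
Proof. by rewrite normal_pdfE. Qed.

(** The Gaussian mass of the unit cell from n to n + 1. *)
Let cell (n : nat) : R := fine (normal_prob m s `[n%:R, n.+1%:R[).

Let cell_fin (A : set R) : measurable A -> normal_prob m s A \is a fin_num.
Proof. by move=> mA; rewrite fin_num_measure. Qed.

Let cell_len (n : nat) : mu (`[n%:R, n.+1%:R[%classic : set R) = 1%E.
Proof.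
rewrite lebesgue_measure_itv /= lte_fin ltr_nat ltnSn -EFinD.
by rewrite -natr1 addrAC subrr add0r.
Qed.

Let cell_le (n : nat) (M : R) : 0 <= M ->
  (forall u, n%:R <= u < n.+1%:R -> pk * g u <= M) -> cell n <= M.
Proof.
move=> M0 H; rewrite -lee_fin fineK ?cell_fin//.
rewrite /normal_prob.
apply: (@le_trans _ _ (\int[mu]_(x in `[n%:R, n.+1%:R[) M%:E)%E); last first.
  by rewrite integral_cst//= [X in (_ * X)%E]cell_len mule1.
apply: ge0_le_integral => //=.
- by move=> u _; rewrite lee_fin normal_pdf_ge0.
- by apply: measurable_funTS; apply/measurable_EFinP;
  exact: measurable_normal_pdf.
- by move=> u; rewrite in_itv /= => Hu; rewrite lee_fin pdfE H.
Qed.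

Let cell_ge (n : nat) (M : R) : 0 <= M ->
  (forall u, n%:R <= u < n.+1%:R -> M <= pk * g u) -> M <= cell n.
Proof.
move=> M0 H; rewrite -lee_fin fineK ?cell_fin//.
rewrite /normal_prob.
apply: (@le_trans _ _ (\int[mu]_(x in `[n%:R, n.+1%:R[) M%:E)%E).
  by rewrite integral_cst//= [X in (_ * X)%E]cell_len mule1.
apply: ge0_le_integral => //=.
- by apply: measurable_funTS; apply/measurable_EFinP;
  exact: measurable_normal_pdf.
- by move=> u; rewrite in_itv /= => Hu; rewrite lee_fin pdfE H.
Qed.

Let sum_cell (a b : nat) : (a <= b)%N ->
  \sum_(a <= k < b) cell k = fine (normal_prob m s `[a%:R, b%:R[).
Proof.
elim: b => [|b IH].
  rewrite leqn0 => /eqP ->; rewrite big_geq// set_itv_ge ?measure0//.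
  by rewrite bnd_simp ltxx.
rewrite leq_eqVlt => /predU1P[->|]; last first.
  rewrite ltnS => ab; rewrite big_nat_recr //= IH// /cell -fineD ?cell_fin//.
  rewrite -measureU//; last first.
    rewrite -subset0 => u /= []; rewrite !in_itv/= => /andP[_ u1] /andP[u2 _].
    by move: (lt_le_trans u1 u2); rewrite ltxx.
  congr (fine (_ _)); rewrite -itv_bndbnd_setU// bnd_simp.
    by rewrite ler_nat.
  by rewrite ler_nat.
rewrite big_geq// set_itv_ge ?measure0//.
by rewrite bnd_simp ltxx.
Qed.

Section Compare.
Variables (k0 : nat).
Hypothesis (k0m : k0%:R <= m < k0.+1%:R).

Let right_le k : (k0 < k)%N -> pk * g k.+1%:R <= cell k.
Proof.
move=> kk; apply: cell_ge => [|u /andP[u1 u2]].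
  by rewrite mulr_ge0 ?normal_fun_ge0 ?ltW.
rewrite ler_pM2l// g_mono//; move/andP: k0m => [_ m1].
have : k0.+1%:R <= k%:R :> R by rewrite ler_nat.
by move=> ?; rewrite !ger0_norm ?subr_ge0; lra.
Qed.

Let right_ge k : (k0 < k)%N -> cell k <= pk * g k%:R.
Proof.
move=> kk; apply: cell_le => [|u /andP[u1 u2]].
  by rewrite mulr_ge0 ?normal_fun_ge0 ?ltW.
rewrite ler_pM2l// g_mono//; move/andP: k0m => [_ m1].
have : k0.+1%:R <= k%:R :> R by rewrite ler_nat.
by move=> ?; rewrite !ger0_norm ?subr_ge0; lra.
Qed.

Let left_le k : (k < k0)%N -> pk * g k%:R <= cell k.
Proof.
move=> kk; apply: cell_ge => [|u /andP[u1 u2]].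
  by rewrite mulr_ge0 ?normal_fun_ge0 ?ltW.
rewrite ler_pM2l// g_mono//; move/andP: k0m => [m1 _].
have : k.+1%:R <= k0%:R :> R by rewrite ler_nat.
by move=> ?; rewrite !ler0_norm ?subr_le0; lra.
Qed.

Let left_ge k : (k < k0)%N -> cell k <= pk * g k.+1%:R.
Proof.
move=> kk; apply: cell_le => [|u /andP[u1 u2]].
  by rewrite mulr_ge0 ?normal_fun_ge0 ?ltW.
rewrite ler_pM2l// g_mono//; move/andP: k0m => [m1 _].
have : k.+1%:R <= k0%:R :> R by rewrite ler_nat.
by move=> ?; rewrite !ler0_norm ?subr_le0; lra.
Qed.

Let F k : R := pk * g k%:R.
Let F_le k : F k <= pk. Proof. by rewrite /F ger_pMr. Qed.
Let F_ge k : 0 <= F k. Proof. by rewrite mulr_ge0 ?normal_fun_ge0 ?ltW. Qed.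
Let cell_ge0 k : 0 <= cell k. Proof. exact/fine_ge0/measure_ge0. Qed.
Let cell_le_peak k : cell k <= pk.
Proof. by apply: cell_le => [|u _]; rewrite ?ger_pMr// ltW. Qed.

Let upper (a b : nat) : (a <= b)%N ->
  \sum_(a <= k < b) (F k - cell k) <= if (b <= k0)%N then 0 else pk *+ 2 - F b.
Proof.
elim: b => [|b IH].
  by rewrite leqn0 => /eqP ->; rewrite big_geq.
rewrite leq_eqVlt => /predU1P[->|].
  rewrite big_geq//; case: ifP => // _; rewrite mulr2n.
  by have := F_le b.+1; have := pk0; lra.
rewrite ltnS => ab; rewrite big_nat_recr //=; have {IH} := IH ab.
case: (ltngtP b k0) => bk.
- by have : F b <= _ := left_le _ bk; lra.
- by have : F b.+1 <= _ := right_le _ bk; lra.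
- by have := F_le b; have := F_le b.+1; have := cell_ge0 b; rewrite mulr2n; lra.
Qed.

Let lower (a b : nat) : (a <= b)%N ->
  \sum_(a <= k < b) (cell k - F k) <= if (b <= k0)%N then F b else pk.
Proof.
elim: b => [|b IH].
  by rewrite leqn0 => /eqP ->; rewrite big_geq// F_ge.
rewrite leq_eqVlt => /predU1P[->|].
  by rewrite big_geq//; case: ifP => // _; exact: ltW.
rewrite ltnS => ab; rewrite big_nat_recr //=; have {IH} := IH ab.
case: (ltngtP b k0) => bk.
- by have : _ <= F b.+1 := left_ge _ bk; lra.
- by have : _ <= F b := right_ge _ bk; lra.
- by have := cell_le_peak b; lra.
Qed.

(** On each side of m the density is monotone, so that the errors telescope and
    add up to at most twice its peak. *)
Lemma gauss_sum_upper (a b : nat) : (a <= b)%N ->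
  \sum_(a <= k < b) g k%:R <= pk^-1 + 2.
Proof.
move=> ab; rewrite -(ler_pM2l pk0) mulrDr mulfV ?gt_eqF// mulr_sumr.
have := upper _ _ ab; rewrite sumrB sum_cell//.
have : fine (normal_prob m s `[a%:R, b%:R[) <= 1.
  by rewrite -lee_fin fineK ?cell_fin// probability_le1.
have := F_ge b; have := pk0; case: ifP => _; rewrite ?mulr2n; lra.
Qed.

Lemma gauss_sum_lower (a b : nat) : (a <= b)%N ->
  pk^-1 * fine (normal_prob m s `[a%:R, b%:R[) - 1 <= \sum_(a <= k < b) g k%:R.
Proof.
move=> ab; rewrite -(ler_pM2l pk0) mulrBr mulrA mulfV ?gt_eqF// mul1r mulr_sumr.
have := lower _ _ ab; rewrite sumrB sum_cell//.
by have := F_le b; case: ifP => _; lra.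
Qed.
End Compare.

Lemma gauss_sum_le (a b : nat) : 0 <= m -> (a <= b)%N ->
  \sum_(a <= k < b) g k%:R <= pk^-1 + 2.
Proof. by move=> m0; exact: gauss_sum_upper (truncn_itv m0) _ _. Qed.

(** Outside the interval the density is at most 2 exp (- D^2 / (4 s^2)) times the
    normal density with twice the standard deviation, whose integral is one. *)
Let tail (D a b : R) : 0 <= D -> a <= m - D -> m + D <= b ->
  fine (normal_prob m s `[a, b[) >= 1 - 2 * expR (- (D ^+ 2 / (4 * s ^+ 2))).
Proof.
move=> D0 aD Db; set c := 2 * _.
have c0 : 0 <= c by rewrite mulr_ge0 ?expR_ge0.
have -> : fine (normal_prob m s `[a, b[) =
    1 - fine (normal_prob m s (~` `[a, b[%classic)).
  have F : normal_prob m s `[a, b[ \is a fin_num by exact: cell_fin.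
  have -> : (normal_prob m s (~` `[a, b[) = 1 - normal_prob m s `[a, b[)%E.
    exact: probability_setC.
  case: (normal_prob m s _) F => [r| |] //= _.
  by rewrite opprB addrC subrK.
rewrite lerD2l lerN2 -lee_fin fineK ?cell_fin//; last exact: measurableC.
have s2 : 2 * s != 0 by rewrite mulf_neq0.
have E u : (~` `[a, b[%classic) u ->
    normal_pdf m s u <= c * normal_pdf m (2 * s) u.
  move=> /= Hu.
  have {Hu} Hu : D ^+ 2 <= (u - m) ^+ 2.
    have : D <= `|u - m|.
      rewrite leNgt; apply/negP; rewrite ltr_distl => /andP[u1 u2]; apply: Hu.
      rewrite in_itv /=; apply/andP; split; lra.
    by rewrite -(real_normK (num_real (u - m))) => ?; rewrite lerXn2r ?nnegrE.
  rewrite !normal_pdfE// /c.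
  have -> : normal_peak (2 * s) = pk / 2.
    rewrite /normal_peak exprMn -mulrA -mulrnAr sqrtrM ?sqr_ge0//.
    by rewrite sqrtr_sqr ger0_norm// invfM mulrC.
  rewrite [leRHS](_ : _ = pk * (expR (- (D ^+ 2 / (4 * s ^+ 2))) * normal_fun m (2 * s) u)).
    2: by field.
  rewrite ler_pM2l// /normal_fun -expRD ler_expR !mulNr -opprD lerN2.
  rewrite [leRHS](_ : _ = (u - m) ^+ 2 / s ^+ 2 / 2); last by field.
  rewrite [leLHS](_ : _ = (2 * D ^+ 2 + (u - m) ^+ 2) / s ^+ 2 / 8);
    last by field.
  have : 0 <= ((u - m) ^+ 2 - D ^+ 2) / s ^+ 2
    by rewrite mulr_ge0 ?invr_ge0 ?sqr_ge0// subr_ge0.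
  have : 0 <= (u - m) ^+ 2 / s ^+ 2 by rewrite mulr_ge0 ?invr_ge0 ?sqr_ge0.
  lra.
apply: (@le_trans _ _ (\int[mu]_(u in ~` `[a, b[) (c%:E * (normal_pdf m (2 * s) u)%:E))%E).
  apply: ge0_le_integral => //=.
  - exact: measurableC.
  - by move=> u _; rewrite lee_fin normal_pdf_ge0.
  - by apply: measurable_funTS; apply/measurable_EFinP;
    exact: measurable_normal_pdf.
  - apply: measurable_funeM.
    by apply: measurable_funTS; apply/measurable_EFinP;
      exact: measurable_normal_pdf.
rewrite ge0_integralZl//=.
- rewrite -[leRHS]mule1; apply: lee_wpmul2l; first by rewrite lee_fin.
  have /= H := @probability_le1 _ _ _ (normal_prob m (2 * s)) (~` `[a, b[%classic).
  by apply: H; exact: measurableC.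
- exact: measurableC.
- by apply: measurable_funTS; apply/measurable_EFinP;
  exact: measurable_normal_pdf.
- by move=> u _; rewrite lee_fin normal_pdf_ge0.
Qed.

(** Here D is a lower bound on the distance from m to both ends of the range. *)
Lemma gauss_sum_ge (D : R) (a b : nat) : 0 <= m -> (a <= b)%N ->
  0 <= D -> a%:R <= m - D -> m + D <= b%:R ->
  pk^-1 * (1 - 2 * expR (- (D ^+ 2 / (4 * s ^+ 2)))) - 1 <= \sum_(a <= k < b) g k%:R.
Proof.
move=> m0 ab D0 aD Db;
  apply: le_trans (gauss_sum_lower _ (truncn_itv m0) _ _ ab).
by rewrite lerD2r ler_wpM2l ?tail// invr_ge0 ltW.
Qed.

End GaussianSum.

(** * A local limit theorem for unimodal laws *)

Lemma expR_sub1_le (R : realType) (t : R) : `|expR t - 1| <= `|t| * expR `|t|.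
Proof.
have H (v : R) : 0 <= v -> expR v - 1 <= v * expR v.
  move=> v0; have := expR_ge1Dx (- v); rewrite expRN => H.
  have e0 := expR_gt0 v.
  have : (1 - v) * expR v <= 1 by rewrite -ler_pdivlMr// mul1r.
  by lra.
have [t0|t0] := leP 0 t.
  rewrite !ger0_norm ?H// subr_ge0 -expR0 ler_expR//.
rewrite ltr0_norm; last by rewrite subr_lt0 -expR0 ltr_expR.
rewrite (ltr0_norm t0).
have := expR_ge1Dx t; have : 1 <= expR (- t) by rewrite -expR0 ler_expR; lra.
by nra.
Qed.

Lemma expRN_le_inv (R : realType) (t : R) : 0 < t -> expR (- t) <= t^-1.
Proof.
move=> t0; rewrite expRN lef_pV2 ?posrE ?expR_gt0//.
by have := expR_ge1Dx t; lra.
Qed.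

(** The polynomial error is absorbed by a small part of the Gaussian weight. *)
Lemma cube_le_expR (R : realType) (c w : R) : 0 < c -> 0 <= w ->
  (1 + w) ^+ 3 <= 8 * (1 + 2 / c ^+ 2) * expR (c * w ^+ 2).
Proof.
move=> c0 w0.
have H : (1 + w) ^+ 3 <= 8 * (1 + w ^+ 4).
  have : 0 <= w ^+ 2 by rewrite sqr_ge0.
  have := sqr_ge0 (w - 1); have := sqr_ge0 (w ^+ 2 - w); nra.
apply: (le_trans H); rewrite -mulrA ler_pM2l//.
have := @expR_ge1Dxn _ (c * w ^+ 2) 1 (mulr_ge0 (ltW c0) (sqr_ge0 _)) => E.
apply: (@le_trans _ _ ((1 + 2 / c ^+ 2) * (1 + (c * w ^+ 2) ^+ 2 / 2))).
  rewrite [leRHS](_ : _ = 1 + w ^+ 4 + 2 / c ^+ 2 + (c * w ^+ 2) ^+ 2 / 2).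
    by rewrite -addrA lerDl addr_ge0// ?divr_ge0 ?sqr_ge0.
  by field; rewrite gt_eqF.
rewrite ler_pM2l//; last by rewrite ltr_pwDl// divr_ge0 ?sqr_ge0.
Qed.

(** The law p on 0, ..., N is assumed to satisfy the expansion
    ln (p (k + 1)) - ln (p k) = - kap (k - m) / N + O(1/N + ((k - m)/N)^2), with
    constant C, in the bulk |k - m| <= del N. *)
Section LocalLimit.
Variables (R : realType) (kap C del : R).
Hypotheses (kap0 : 0 < kap) (C0 : 0 <= C) (del0 : 0 < del).
Hypothesis (del_small : 32 * (C + kap) * del <= kap).

(* C2 bounds the logarithmic error eps, C3 the pointwise distance to the
   Gaussian profile, C4 that distance summed over the bulk, C5 the mass outside
   the bulk, C7 the missing Gaussian tail, and C6 the error in the normalizing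
   constant. *)
Let C1 := C + kap.
Let C2 := 2 * C1.
Let C3 := C2 * expR (4 * C2) * (8 * (1 + 2 / (kap / 8) ^+ 2)).
Let cpi : R := Num.sqrt (pi *+ 2).
Let C4 := C3 * (2 * cpi / Num.sqrt kap + 2).
Let C5 := expR (4 * C2) * 32 / (kap * del ^+ 2).
Let C7 := 32 * cpi / (Num.sqrt kap * kap * del ^+ 2).
Let C6 := C4 + C5 + 2 + C7.

Let C1_gt0 : 0 < C1. Proof. by rewrite /C1; move: kap0 C0; lra. Qed.
Let C2_gt0 : 0 < C2. Proof. by rewrite /C2; move: C1_gt0; lra. Qed.
Let cpi0 : 0 < cpi. Proof. by rewrite sqrtr_gt0 mulrn_wgt0// pi_gt0. Qed.
Let skap0 : 0 < Num.sqrt kap. Proof. by rewrite sqrtr_gt0. Qed.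
Let C3_gt0 : 0 < C3.
Proof.
by rewrite !mulr_gt0 ?expR_gt0// ltr_pwDl// divr_ge0 ?sqr_ge0.
Qed.

Let C4_ge0 : 0 <= C4.
Proof.
rewrite mulr_ge0 ?(ltW C3_gt0)// addr_ge0// divr_ge0 ?(ltW skap0)//.
by rewrite mulr_ge0// ltW.
Qed.
Let C5_ge0 : 0 <= C5.
Proof. by rewrite divr_ge0// mulr_ge0 ?expR_ge0 ?sqr_ge0 ?(ltW kap0). Qed.
Let C7_ge0 : 0 <= C7.
Proof.
rewrite divr_ge0 ?mulr_ge0 ?sqr_ge0 ?(ltW cpi0)//; exact: ltW.
Qed.

Section FixedSize.
Variables (N : nat) (m : R) (p : nat -> R).
Local Notation n := (N%:R : R).
Hypotheses (n1 : 1 <= n) (n2 : 2 <= del * n)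
  (n3 : 2 * (2 * kap + C) < kap * del * n)
  (n4 : 2 * C6 <= Num.sqrt n / Num.sqrt kap * cpi).
Hypotheses (m_ge : del * n + 2 <= m).
Hypotheses (p_ge0 : forall k, 0 <= p k) (p_out : forall k, (N < k)%N -> p k = 0)
  (sum_p : \sum_(k < N.+1) p k = 1).
Hypothesis (p_bulk : forall k : nat, `|k%:R - m| <= del * n -> 0 < p k).
Hypothesis (p_ratio : forall k : nat, `|k%:R - m| <= del * n ->
  `|ln (p k.+1) - ln (p k) + kap * (k%:R - m) / n|
     <= C * (n^-1 + ((k%:R - m) / n) ^+ 2)).
Hypothesis (p_unimodal : forall i k : nat, 0 < p i -> p i.+1 <= p i ->
  (i <= k)%N -> p k.+1 <= p k).

Let S := Num.sqrt n.
Let s := S / Num.sqrt kap.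
(** The distance to m on the scale sqrt N of the fluctuations. *)
Let w (k : nat) : R := `|k%:R - m| / S.
(** The logarithm of p with the Gaussian profile divided out. *)
Let T (k : nat) : R := ln (p k) + kap * (k%:R - m) ^+ 2 / (2 * n).
(** The Gaussian profile, equal to one at m. *)
Let g (k : nat) : R := normal_fun m s k%:R.

Let n0 : 0 < n. Proof. exact: lt_le_trans n1. Qed.
Let S0 : 0 < S. Proof. by rewrite sqrtr_gt0. Qed.
Let S1 : 1 <= S. Proof. by rewrite -sqrtr1 ler_wsqrtr. Qed.
Let SE : S ^+ 2 = n. Proof. by rewrite sqr_sqrtr// ltW. Qed.
Let s_gt0 : 0 < s. Proof. by rewrite divr_gt0. Qed.
Let sE : s ^+ 2 = n / kap.
Proof. by rewrite expr_div_n SE sqr_sqrtr// ltW. Qed.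
Let w_ge0 k : 0 <= w k. Proof. by rewrite divr_ge0 ?(ltW S0). Qed.
Let wE k : w k ^+ 2 = (k%:R - m) ^+ 2 / n.
Proof. by rewrite expr_div_n SE real_normK ?num_real. Qed.
Let wS k : `|k%:R - m| = w k * S. Proof. by rewrite divfK ?gt_eqF. Qed.
Let gE k : g k = expR (- (kap * w k ^+ 2 / 2)).
Proof.
rewrite /g /normal_fun wE sE; congr expR; rewrite mulr2n; field.
by rewrite !gt_eqF ?addr_gt0 ?mulr_gt0.
Qed.
Let g2E k : normal_fun m (2 * s) k%:R = expR (- (kap / 8 * w k ^+ 2)).
Proof.
rewrite /normal_fun wE exprMn sE; congr expR; rewrite mulr2n; field.
by rewrite !gt_eqF ?addr_gt0 ?mulr_gt0.
Qed.
Let peakE (t : R) : 0 < t -> (normal_peak t)^-1 = t * cpi.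
Proof.
by move=> t0; rewrite invrK -mulrnAr sqrtrM ?sqr_ge0// sqrtr_sqr gtr0_norm.
Qed.

Let T_step (k : nat) : `|k%:R - m| <= del * n ->
  `|T k.+1 - T k| <= C1 * (n^-1 + ((k%:R - m) / n) ^+ 2).
Proof.
move=> kb; have := p_ratio _ kb; rewrite /T -natr1.
set X := ln _ - _ + _ => H.
have -> : ln (p k.+1) + kap * (k%:R + 1 - m) ^+ 2 / (2 * n)
    - (ln (p k) + kap * (k%:R - m) ^+ 2 / (2 * n)) = X + kap * n^-1 / 2.
  by rewrite /X; field; rewrite gt_eqF.
apply: (le_trans (ler_normD _ _)).
have i0 : 0 < n^-1 by rewrite invr_gt0.
have -> : `|kap * n^-1 / 2| = kap * n^-1 / 2.
  by rewrite ger0_norm// !mulr_ge0// ltW.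
move: H; set Y := (_ / _) ^+ 2 => H.
have H1 : 0 <= kap * Y by rewrite mulr_ge0 ?sqr_ge0// ltW.
have H2 : 0 < kap * n^-1 by rewrite mulr_gt0.
by rewrite /C1 mulrDl; lra.
Qed.

Let T_chain (B : R) (a b : nat) : (a <= b)%N -> B <= del * n ->
  (forall i, (a <= i <= b)%N -> `|i%:R - m| <= B) ->
  `|T b - T a| <= (b%:R - a%:R) * (C1 * (n^-1 + (B / n) ^+ 2)).
Proof.
move=> ab Bn; elim: b ab => [|b IH] ab H.
  by move: ab; rewrite leqn0 => /eqP ->; rewrite !subrr normr0 mul0r.
move: ab; rewrite leq_eqVlt => /predU1P[->|].
  by rewrite !subrr normr0 mul0r.
rewrite ltnS => ab.
have {}IH := IH ab _.
have {}IH : `|T b - T a| <= (b%:R - a%:R) * (C1 * (n^-1 + (B / n) ^+ 2)).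
  by apply: IH => i /andP[i1 i2]; apply: H; rewrite i1 leqW.
have Hb : `|b%:R - m| <= B by apply: H; rewrite ab leqnSn.
have := T_step b (le_trans Hb Bn).
have -> : T b.+1 - T a = (T b.+1 - T b) + (T b - T a) by ring.
move=> H1; apply: (le_trans (ler_normD _ _)).
have H2 : C1 * (n^-1 + ((b%:R - m) / n) ^+ 2) <= C1 * (n^-1 + (B / n) ^+ 2).
  rewrite ler_pM2l// lerD2l -(real_normK (num_real (_ / n))) lerXn2r ?nnegrE//.
    by rewrite divr_ge0 ?(ltW n0)// (le_trans _ Hb).
  by rewrite normrM (ger0_norm (_ : 0 <= n^-1)) ?ler_pM2r ?invr_ge0 ?invr_gt0// ltW.
by rewrite -natr1; lra.
Qed.

Let k0 := Num.truncn m.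
Let k0m : k0%:R <= m < k0.+1%:R.
Proof. by apply: truncn_itv; move: m_ge n2; lra. Qed.

Let eps k : R := T k - T k0.

Let eps_le k : `|k%:R - m| <= del * n -> `|eps k| <= C2 / S * (1 + w k) ^+ 3.
Proof.
move=> kb.
have H : `|eps k| <= (`|k%:R - m| + 1) * (C1 * (n^-1 + ((`|k%:R - m| + 1) / n) ^+ 2)).
  (* All the points between k0 and k are at distance at most B from m. *)
  set u := `|k%:R - m| in kb *; pose B := Num.max 1 u.
  have B1 : 1 <= B by rewrite le_max lexx.
  have Bu : u <= B by rewrite le_max lexx orbT.
  have uB : B <= u + 1.
    by rewrite ge_max lerDr lerDl ler01 normr_ge0.
  have Bn : B <= del * n by rewrite ge_max kb andbT (le_trans _ n2)// ler1n.
  have [m1 m2] := andP k0m; rewrite -natr1 in m2.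
  have [u1 u2] : - u <= k%:R - m /\ k%:R - m <= u.
    by apply/andP; rewrite -ler_norml.
  have X a : 0 <= a -> a <= u + 1 -> a * (C1 * (n^-1 + (B / n) ^+ 2)) <=
      (u + 1) * (C1 * (n^-1 + ((u + 1) / n) ^+ 2)).
    move=> a0 au; apply: ler_pM => //.
      by rewrite mulr_ge0 ?(ltW C1_gt0)// addr_ge0 ?sqr_ge0// invr_ge0 ltW.
    rewrite ler_pM2l// lerD2l lerXn2r ?nnegrE ?divr_ge0 ?ler_pM2r ?invr_gt0//;
      by [exact: ltW|lra].
  have [k0k|kk0] := leqP k0 k.
    apply: (le_trans (T_chain B k0 k k0k Bn _)).
      move=> i /andP[i1 i2]; rewrite ler_norml.
      have : k0%:R <= i%:R :> R by rewrite ler_nat.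
      have : i%:R <= k%:R :> R by rewrite ler_nat.
      by move=> ? ?; apply/andP; split; lra.
    have : k0%:R <= k%:R :> R by rewrite ler_nat.
    by move=> ?; apply: X; lra.
  rewrite /eps distrC.
  apply: (le_trans (T_chain B k k0 (ltnW kk0) Bn _)).
    move=> i /andP[i1 i2]; rewrite ler_norml.
    have : k%:R <= i%:R :> R by rewrite ler_nat.
    have : i%:R <= k0%:R :> R by rewrite ler_nat.
    by move=> ? ?; apply/andP; split; lra.
  have : k%:R <= k0%:R :> R by rewrite ler_nat ltnW.
  by move=> ?; apply: X; lra.
apply: (le_trans H).
rewrite wS -SE; set v := w k.
have v0 : 0 <= v := w_ge0 k.
have A : v * S + 1 <= S * (1 + v) by rewrite mulrDr mulr1 mulrC addrC lerD2r.
apply: (@le_trans _ _ (S * (1 + v) * (C1 * ((S ^+ 2)^-1 + (S * (1 + v) / S ^+ 2) ^+ 2)))).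
  have B0 : 0 <= v * S + 1 by rewrite addr_ge0// mulr_ge0 ?(ltW S0).
  apply: ler_pM => //.
    by rewrite mulr_ge0 ?(ltW C1_gt0)// addr_ge0 ?sqr_ge0// invr_ge0 sqr_ge0.
  rewrite ler_pM2l// lerD2l lerXn2r ?nnegrE//.
  - by rewrite divr_ge0 ?sqr_ge0.
  - by rewrite divr_ge0 ?sqr_ge0// (le_trans B0 A).
  - by rewrite ler_pM2r// invr_gt0 exprn_gt0.
have -> : S * (1 + v) * (C1 * ((S ^+ 2)^-1 + (S * (1 + v) / S ^+ 2) ^+ 2))
   = C1 / S * ((1 + v) * (1 + (1 + v) ^+ 2)) by field; rewrite gt_eqF.
have -> : C2 / S * (1 + v) ^+ 3 = C1 / S * (2 * (1 + v) ^+ 3) by rewrite /C2;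
  ring.
rewrite ler_pM2l ?divr_gt0//.
have v1 : 1 <= 1 + v by rewrite lerDl.
have : 1 + v <= (1 + v) ^+ 3 by rewrite ler_eXnr.
by rewrite (_ : (1 + v) * (1 + (1 + v) ^+ 2) = 1 + v + (1 + v) ^+ 3);
  [lra|ring].
Qed.

Let Q := expR (T k0).
Let Q0 : 0 < Q. Proof. exact: expR_gt0. Qed.

Let pE k : `|k%:R - m| <= del * n -> p k = Q * (g k * expR (eps k)).
Proof.
move=> kb; rewrite gE /Q -!expRD -[LHS]lnK ?posrE ?p_bulk//; congr expR.
by rewrite /eps /T wE; field; rewrite !gt_eqF.
Qed.

(** In the bulk the error is, up to a constant, at most half of the Gaussian
    exponent kap w^2 / 2: this is where del has to be small. *)
Let eps_bulk k : `|k%:R - m| <= del * n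
  -> `|eps k| <= 4 * C2 + kap / 4 * w k ^+ 2.
Proof.
move=> kb; apply: (le_trans (eps_le _ kb)).
have v0 := w_ge0 k; have vS : w k <= del * S.
  by rewrite -(ler_pM2r S0) -wS -mulrA -expr2 SE.
move: (w k) v0 vS => v v0 vS.
have H : (1 + v) ^+ 3 <= 4 * (1 + v ^+ 3).
  have -> : 4 * (1 + v ^+ 3) = (1 + v) ^+ 3 + 3 * ((1 + v) * (v - 1) ^+ 2)
    by ring.
  have : 0 <= (1 + v) * (v - 1) ^+ 2.
    by apply: mulr_ge0; [rewrite addr_ge0|exact: sqr_ge0].
  by lra.
have C2S : 0 < C2 / S by rewrite divr_gt0.
apply: (@le_trans _ _ (C2 / S * (4 * (1 + v ^+ 3)))); first by rewrite ler_pM2l.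
rewrite mulrDr mulr1 mulrDr; apply: lerD.
  by rewrite mulrAC ler_pdivrMr// [C2 * 4]mulrC ler_peMr// mulr_ge0// ltW.
rewrite (_ : C2 / S * (4 * v ^+ 3) = 8 * C1 * (v / S) * v ^+ 2); last first.
  by rewrite /C2; field; rewrite gt_eqF.
apply: ler_wpM2r; first exact: sqr_ge0.
have : C1 * (v / S) <= C1 * del by rewrite ler_pM2l// ler_pdivrMr.
by move: del_small; rewrite -/C1; lra.
Qed.

Let p_close k : `|k%:R - m| <= del * n ->
  `|p k / Q - g k| <= C3 / S * normal_fun m (2 * s) k%:R.
Proof.
move=> kb; rewrite pE// mulrAC mulfV ?gt_eqF// mul1r.
have g0 : 0 < g k by rewrite gE expR_gt0.
rewrite -[X in _ - X]mulr1 -mulrBr normrM (gtr0_norm g0).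
have H1 := expR_sub1_le _ (eps k).
have H2 := eps_bulk _ kb; have H3 := eps_le _ kb.
have c0 : 0 < kap / 8 by rewrite divr_gt0.
have H4 := cube_le_expR _ _ _ c0 (w_ge0 k).
rewrite g2E; rewrite gE in g0 *; set v := w k in H2 H3 H4 *.
set E8 := 8 * _ in H4.
apply: (@le_trans _ _ (expR (- (kap * v ^+ 2 / 2)) *
   ((C2 / S * (E8 * expR (kap / 8 * v ^+ 2))) * expR (4 * C2 + kap / 4 * v ^+ 2)))).
  rewrite ler_pM2l//; apply: (le_trans H1); apply: ler_pM.
  - exact: normr_ge0.
  - exact: expR_ge0.
  - by apply: (le_trans H3); rewrite ler_pM2l ?divr_gt0.
  - by rewrite ler_expR.
rewrite (_ : expR (- (kap / 8 * v ^+ 2)) = expR (- (kap * v ^+ 2 / 2))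
    * (expR (kap / 8 * v ^+ 2) * expR (kap / 4 * v ^+ 2))); last first.
  by rewrite -!expRD; congr expR; field.
by rewrite le_eqVlt; apply/orP; left; apply/eqP; rewrite expRD /C3 -/E8; ring.
Qed.

(** The first and the last integer of the bulk. *)
Let a := (Num.truncn (m - del * n)).+1.
Let b := Num.truncn (m + del * n).

Let aP : m - del * n < a%:R <= m - del * n + 1.
Proof.
have H : 0 <= m - del * n by move: m_ge; lra.
have /andP[H1 H2] := truncn_itv H; rewrite /a H2 -natr1.
by rewrite lerD2r.
Qed.

Let bP : m + del * n - 1 < b%:R <= m + del * n.
Proof.
have H : 0 <= m + del * n by move: m_ge n2; lra.
have /andP[H1 H2] := truncn_itv H; rewrite H1 andbT.
by move: H2; rewrite -/b -natr1; lra.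
Qed.

Let bulk_le k : (a <= k)%N -> (k <= b)%N -> `|k%:R - m| <= del * n.
Proof.
rewrite -(ler_nat R) -(ler_nat R) => ak kb.
by rewrite ler_norml; apply/andP; move: aP bP => /andP[? ?] /andP[? ?]; split;
  lra.
Qed.

Let ab : (a < b)%N.
Proof.
by rewrite -(ltr_nat R); move: aP bP n2 => /andP[? ?] /andP[? ?]; lra.
Qed.

Let sum_close : `|\sum_(a <= k < b.+1) p k / Q - \sum_(a <= k < b.+1) g k| <= C4.
Proof.
rewrite -sumrB; apply: (le_trans (ler_norm_sum _ _ _)).
apply: (@le_trans _ _ (\sum_(a <= k < b.+1) C3 / S * normal_fun m (2 * s) k%:R)).
  rewrite big_nat [leRHS]big_nat; apply: ler_sum => k /andP[ak kb].
  by apply: p_close; apply: bulk_le.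
rewrite -mulr_sumr.
have s20 : 0 < 2 * s by rewrite mulr_gt0.
have m0 : 0 <= m by move: m_ge n2; lra.
have := @gauss_sum_le _ _ _ s20 a b.+1 m0 (ltnW (ltnW ab)).
rewrite peakE// => H.
have C3S : 0 < C3 / S by rewrite divr_gt0.
apply: (@le_trans _ _ (C3 / S * (2 * s * cpi + 2))); first by rewrite ler_pM2l.
rewrite /C4 -mulrA ler_pM2l// mulrDr; apply: lerD.
  rewrite /s le_eqVlt; apply/orP; left; apply/eqP; field.
  by rewrite !gt_eqF.
by rewrite mulrC ler_pdivrMr// ler_peMr.
Qed.

(** Half of the Gaussian exponent at the ends of the bulk is at least x. *)
Let x := kap * del ^+ 2 * n / 16.
Let x0 : 0 < x.
Proof. by rewrite /x !mulr_gt0// exprn_gt0. Qed.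

Let edge_le k : `|k%:R - m| <= del * n -> del * n / 2 <= `|k%:R - m| ->
  p k <= Q * (expR (4 * C2) / x).
Proof.
move=> kb ke; rewrite pE// ler_pM2l//.
have wk : del ^+ 2 * n / 4 <= w k ^+ 2.
  rewrite wE -(real_normK (num_real (k%:R - m))) ler_pdivlMr//.
  rewrite (_ : del ^+ 2 * n / 4 * n = (del * n / 2) ^+ 2); last by field.
  by rewrite lerXn2r ?nnegrE// !mulr_ge0// ltW.
apply: (@le_trans _ _ (expR (4 * C2) * expR (- x))); last first.
  by rewrite ler_pM2l ?expR_gt0// expRN_le_inv.
rewrite gE -!expRD ler_expR.
have := ler_norm (eps k); have := eps_bulk _ kb; rewrite /x.
by move: wk; rewrite -(ler_pM2l kap0); lra.
Qed.

(** At the ends of the bulk the ratio of consecutive probabilities is strictly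
    on the right side of one, so unimodality bounds the tails by the end
    values. *)
Let p_right j : (b <= j)%N -> p j <= p b.
Proof.
have [k kE] : exists k, b = k.+1 by exists b.-1;
  rewrite prednK// (leq_trans _ ab).
have ka : (a <= k)%N by rewrite -ltnS -kE.
have kb : `|k%:R - m| <= del * n by rewrite bulk_le// kE.
have bb : `|b%:R - m| <= del * n by rewrite bulk_le// ltnW.
have pk0 := p_bulk _ kb; have pb0 := p_bulk _ bb.
have H : p k.+1 <= p k.
  rewrite -kE -ler_ln ?posrE// kE.
  have := p_ratio _ kb; rewrite ler_norml => /andP[_].
  have /andP[b1 _] := bP; rewrite kE -natr1 in b1.
  have [u1 u2] : del * n - 2 <= k%:R - m /\ k%:R - m <= del * n.
    by move: kb; rewrite ler_norml => /andP[_ ?]; split => //; lra.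
  have i0 : 0 < n^-1 by rewrite invr_gt0.
  have v1 : del - 2 / n <= (k%:R - m) / n.
    by rewrite ler_pdivlMr// mulrBl divfK ?gt_eqF.
  have v2 : (k%:R - m) / n <= del by rewrite ler_pdivrMr.
  have v0 : 0 <= (k%:R - m) / n by rewrite divr_ge0 ?(ltW n0)//; move: n2 u1;
    lra.
  have n3' : 2 * (2 * kap + C) / n < kap * del by rewrite ltr_pdivrMr.
  rewrite -[kap * _ / n]mulrA; set v := ((k%:R - m) / n) in v0 v1 v2 *.
  have v3 : C * v ^+ 2 <= kap * del / 32.
    have : C * v ^+ 2 <= C * (del * del) by rewrite ler_wpM2l// expr2 ler_pM.
    have : C * del <= kap / 32.
      have : 0 < kap * del by rewrite mulr_gt0.
      by move: del_small; lra.
    rewrite -(ler_pM2r del0); lra.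
  have v4 : kap * del - 2 * kap / n <= kap * v.
    by move: v1; rewrite -(ler_pM2l kap0) mulrBr; lra.
  have v5 : 0 < kap * del by rewrite mulr_gt0.
  by rewrite mulrDr; move: n3'; lra.
elim: j => [|j IH]; first by rewrite leqn0 => /eqP ->.
rewrite leq_eqVlt => /predU1P[<-//|]; rewrite ltnS => bj.
by apply: le_trans (IH bj); apply: (p_unimodal k) => //;
  rewrite (leq_trans _ bj)// kE.
Qed.

Let p_left j : (j <= a)%N -> p j <= p a.
Proof.
have aa : `|a%:R - m| <= del * n by rewrite bulk_le// ltnW.
have aa1 : `|a.+1%:R - m| <= del * n by rewrite bulk_le.
have pa0 := p_bulk _ aa; have pa1 := p_bulk _ aa1.
have H : p a < p a.+1.
  rewrite -ltr_ln ?posrE//.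
  have := p_ratio _ aa; rewrite ler_norml => /andP[+ _].
  have /andP[_ a1] := aP.
  have [u1 u2] : - (del * n) <= a%:R - m /\ a%:R - m <= - (del * n) + 1.
    by move: aa; rewrite ler_norml => /andP[? _]; split => //; lra.
  have i0 : 0 < n^-1 by rewrite invr_gt0.
  have v1 : (a%:R - m) / n <= - del + 1 / n.
    by rewrite ler_pdivrMr// mulrDl divfK ?gt_eqF// mulNr.
  have v2 : - del <= (a%:R - m) / n by rewrite ler_pdivlMr// mulNr.
  have v0 : (a%:R - m) / n <= 0.
    by rewrite mulr_le0_ge0 ?(ltW i0)//; move: n2 u2; lra.
  have n3' : 2 * (2 * kap + C) / n < kap * del by rewrite ltr_pdivrMr.
  rewrite -[kap * _ / n]mulrA; set v := ((a%:R - m) / n) in v0 v1 v2 *.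
  have v3 : C * v ^+ 2 <= kap * del / 32.
    have : C * v ^+ 2 <= C * (del * del).
      by rewrite ler_wpM2l// -sqrrN expr2 ler_pM//; lra.
    have : C * del <= kap / 32.
      have : 0 < kap * del by rewrite mulr_gt0.
      by move: del_small; lra.
    rewrite -(ler_pM2r del0); lra.
  have v4 : kap * v <= - (kap * del) + kap / n.
    by move: v1; rewrite -(ler_pM2l kap0) mulrDr; lra.
  have v5 : 0 < kap * del by rewrite mulr_gt0.
  have v6 : 0 < kap / n by rewrite divr_gt0.
  have v7 : 0 <= C / n by rewrite divr_ge0// ltW.
  by rewrite mulrDr; move: n3'; lra.
have mono i : (i < a)%N -> p i <= p i.+1.
  move=> ia; rewrite leNgt; apply/negP => Hi.
  have pi0 : 0 < p i by apply: le_lt_trans Hi.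
  by have := p_unimodal _ _ pi0 (ltW Hi) (ltnW ia); rewrite leNgt H.
move=> ja; rewrite -(subKn ja); elim: (a - j)%N => [|d IH];
  first by rewrite subn0.
have [da|da] := ltnP d a; last first.
  rewrite (_ : a - d.+1 = a - d)%N//.
  by apply/eqP; rewrite (eqP (_ : a - d == 0)%N) subn_eq0// leqW.
apply: le_trans IH; rewrite (_ : a - d = (a - d.+1).+1)%N;
  last by rewrite subnSK.
by apply: mono; rewrite ltn_subrL.
Qed.

Let bN : (b <= N)%N.
Proof.
rewrite leqNgt; apply/negP => H.
have /p_bulk : `|b%:R - m| <= del * n by rewrite bulk_le// ltnW.
by rewrite p_out// ltxx.
Qed.

Let tails : 0 <= 1 - \sum_(a <= k < b.+1) p k <= Q * C5.
Proof.
have aN : (a <= N)%N by rewrite (leq_trans (ltnW ab)).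
have E : 1 - \sum_(a <= k < b.+1) p k =
    \sum_(0 <= k < a) p k + \sum_(b.+1 <= k < N.+1) p k.
  rewrite -sum_p -(big_mkord xpredT p).
  rewrite (big_cat_nat (leq0n a) (leqW aN)) /=.
  rewrite (big_cat_nat (leqW (ltnW ab)) (bN : (b.+1 <= N.+1)%N)) /=.
  by ring.
rewrite E; apply/andP; split.
  by rewrite addr_ge0// sumr_ge0.
have e1 : del * n / 2 <= `|a%:R - m|.
  by rewrite ler_normr; apply/orP; right; move: aP n2 => /andP[? ?]; lra.
have e2 : del * n / 2 <= `|b%:R - m|.
  by rewrite ler_normr; apply/orP; left; move: bP n2 => /andP[? ?]; lra.
set e := Q * (expR (4 * C2) / x).
have pa : p a <= e by apply: edge_le => //; rewrite bulk_le// ltnW.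
have pb : p b <= e by apply: edge_le => //; rewrite bulk_le// ltnW.
have e0 : 0 <= e by apply: le_trans pa.
have -> : Q * C5 = e * n + e * n.
  rewrite /e /C5 /x; field.
  by rewrite !gt_eqF.
apply: lerD.
  apply: (@le_trans _ _ (\sum_(0 <= k < a) e)).
    rewrite big_nat [leRHS]big_nat; apply: ler_sum => k /andP[_ ka].
    by apply: le_trans pa; rewrite p_left// ltnW.
  by rewrite sumr_const_nat subn0 -[_ *+ _]mulr_natr ler_wpM2l// ler_nat.
apply: (@le_trans _ _ (\sum_(b.+1 <= k < N.+1) e)).
  rewrite big_nat [leRHS]big_nat; apply: ler_sum => k /andP[bk _].
  by apply: le_trans pb; rewrite p_right// ltnW.
by rewrite sumr_const_nat -[_ *+ _]mulr_natr ler_wpM2l// ler_nat subSS leq_subr.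
Qed.

(** The total mass of the Gaussian profile. *)
Let Zs := s * cpi.

Let normalization : `|Q^-1 - Zs| <= C6.
Proof.
have m0 : 0 <= m by move: m_ge n2; lra.
have abS : (a <= b.+1)%N by rewrite ltnW// ltnW.
have U := @gauss_sum_le _ _ _ s_gt0 a b.+1 m0 abS.
have D0 : 0 <= del * n / 2 by rewrite divr_ge0// mulr_ge0// ltW.
have L := @gauss_sum_ge _ _ _ s_gt0 (del * n / 2) a b.+1 m0 abS D0.
rewrite peakE// -/Zs in U L.
have {}L := L _ _.
have {}L : Zs * (1 - 2 * expR (- ((del * n / 2) ^+ 2 / (4 * s ^+ 2)))) - 1 <=
     \sum_(a <= k < b.+1) g k.
  apply: L; first by move: aP n2 => /andP[? ?]; lra.
  by rewrite -(natr1 b); move: bP n2 => /andP[? ?]; lra.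
have Ex : (del * n / 2) ^+ 2 / (4 * s ^+ 2) = x.
  by rewrite sE /x; field; rewrite !gt_eqF ?mulr_gt0.
rewrite Ex in L.
have Zx : Zs * (2 * expR (- x)) <= C7.
  have Zs0 : 0 < Zs by rewrite mulr_gt0.
  apply: (@le_trans _ _ (Zs * (2 * x^-1))).
    by rewrite ler_pM2l// ler_pM2l// expRN_le_inv.
  have -> : Zs * (2 * x^-1) = C7 / S.
    rewrite /Zs /s /x /C7 -SE; field.
    by rewrite !gt_eqF.
  by rewrite ler_pdivrMr// ler_peMr.
move: C5_ge0 C7_ge0 => C5' C7'.
have := sum_close; rewrite -mulr_suml ler_distl => /andP[c1 c2].
have /andP[t1 t2] := tails.
rewrite ler_distl; set P := \sum_(_ <= _ < _) p _ in c1 c2 t1 t2.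
have e1 : P / Q <= Q^-1 by rewrite ler_piMl ?invr_ge0 ?(ltW Q0)//; lra.
have e2 : Q^-1 <= C5 + P / Q.
  by rewrite -(ler_pM2r Q0) mulrDl mulVf ?gt_eqF// divfK ?gt_eqF// mulrC; lra.
rewrite /g in c1 c2 L.
by apply/andP; rewrite /C6; split; lra.
Qed.

Let C6_ge2 : 2 <= C6.
Proof.
by rewrite /C6; move: C4_ge0 C5_ge0 C7_ge0; lra.
Qed.

Let rho_close : `|Zs * Q - 1| <= 2 * C6 * Num.sqrt kap / cpi / S.
Proof.
have Zs0 : 0 < Zs by rewrite mulr_gt0.
have -> : 2 * C6 * Num.sqrt kap / cpi / S = C6 * (2 / Zs).
  by rewrite /Zs /s; field; rewrite !gt_eqF.
have -> : Zs * Q - 1 = (Zs - Q^-1) * Q by rewrite mulrBl mulVf ?gt_eqF.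
have H := normalization; rewrite distrC in H.
rewrite normrM (gtr0_norm Q0); apply: ler_pM => //; first exact: ltW.
rewrite -[Q]invrK -[2 / Zs]invrK lef_pV2 ?posrE ?invr_gt0 ?divr_gt0//.
rewrite invf_div; move: H; rewrite ler_distl => /andP[_ H].
by move: n4; rewrite -/S -/s -/Zs => n4'; lra.
Qed.

Lemma local_limit_fixed (M : R) (k : nat) : `|k%:R - m| <= del * n ->
  (1 + w k) ^+ 3 <= M * S ->
  `|s * p k / normal_pdf 0 1 ((k%:R - m) / s) - 1|
  <= (2 * C2 * expR (C2 * M) + 2 * C6 * Num.sqrt kap / cpi) * (1 + w k) ^+ 3 / S.
Proof.
move=> kb kM.
have -> : s * p k / normal_pdf 0 1 ((k%:R - m) / s) = Zs * Q * expR (eps k).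
  rewrite normal_pdfE ?oner_neq0// pE//.
  have -> : normal_fun 0 1 ((k%:R - m) / s) = g k.
    rewrite /g /normal_fun subr0 expr1n; congr expR; rewrite mulr2n; field.
    by rewrite !gt_eqF.
  have -> : normal_peak 1 = cpi^-1 by rewrite -[LHS]invrK peakE// mul1r.
  rewrite /Zs; field.
  by rewrite !gt_eqF// gE expR_gt0.
have v1 : 1 <= (1 + w k) ^+ 3 by rewrite exprn_ege1// lerDl.
have rc := rho_close.
have r2 : Zs * Q <= 2.
  have : 2 * C6 * Num.sqrt kap / cpi / S <= 1.
    rewrite ler_pdivrMr// mul1r ler_pdivrMr//.
    rewrite [leRHS](_ : _ = S / Num.sqrt kap * cpi * Num.sqrt kap).
      by rewrite ler_pM2r.
    by field; rewrite gt_eqF.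
  by move: rc; rewrite ler_distl => /andP[_]; lra.
have -> : Zs * Q * expR (eps k) - 1 = Zs * Q * (expR (eps k) - 1) + (Zs * Q - 1).
  by ring.
apply: (le_trans (ler_normD _ _)); rewrite 2!mulrDl; apply: lerD.
  have ZQ : 0 < Zs * Q by apply: mulr_gt0 => //; apply: mulr_gt0.
  rewrite normrM (gtr0_norm ZQ).
  have -> : 2 * C2 * expR (C2 * M) * (1 + w k) ^+ 3 / S =
     2 * (C2 / S * (1 + w k) ^+ 3 * expR (C2 * M)) by ring.
  apply: ler_pM => //; first exact: ltW.
  apply: (le_trans (expR_sub1_le _ _)).
  have ek := eps_le _ kb.
  apply: ler_pM; rewrite ?expR_ge0// ler_expR; apply: (le_trans ek).
  by rewrite mulrAC ler_pdivrMr// -[leRHS]mulrA ler_pM2l.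
apply: (le_trans rc); rewrite ler_pM2r ?invr_gt0// ler_peMr//.
by rewrite divr_ge0 ?mulr_ge0 ?(ltW cpi0) ?(ltW skap0)//; move: C6_ge2; lra.
Qed.

End FixedSize.

(** The constant D and the threshold on N are uniform over the laws p and the
    centers m. *)
Lemma local_limit (M : R) : exists D : R, \forall N \near \oo,
  forall (m : R) (p : nat -> R),
  del * N%:R + 2 <= m ->
  (forall k, 0 <= p k) -> (forall k, (N < k)%N -> p k = 0) ->
  \sum_(k < N.+1) p k = 1 ->
  (forall k : nat, `|k%:R - m| <= del * N%:R -> 0 < p k) ->
  (forall k : nat, `|k%:R - m| <= del * N%:R ->
    `|ln (p k.+1) - ln (p k) + kap * (k%:R - m) / N%:R|
      <= C * (N%:R^-1 + ((k%:R - m) / N%:R) ^+ 2)) ->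
  (forall i k : nat, 0 < p i -> p i.+1 <= p i -> (i <= k)%N -> p k.+1 <= p k) ->
  forall k : nat, `|k%:R - m| <= del * N%:R ->
  (1 + `|k%:R - m| / Num.sqrt N%:R) ^+ 3 <= M * Num.sqrt N%:R ->
  `|Num.sqrt N%:R / Num.sqrt kap * p k
      / normal_pdf 0 1 ((k%:R - m) / (Num.sqrt N%:R / Num.sqrt kap)) - 1|
  <= D * (1 + `|k%:R - m| / Num.sqrt N%:R) ^+ 3 / Num.sqrt N%:R.
Proof.
exists (2 * C2 * expR (C2 * M) + 2 * C6 * Num.sqrt kap / cpi).
near=> N => m p h1 h2 h3 h4 h5 h6 h7 k kb kM.
have n1 : 1 <= N%:R :> R by near: N; exact: nbhs_infty_ger.
have n2 : 2 <= del * N%:R.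
  by rewrite mulrC -ler_pdivrMr//; near: N; exact: nbhs_infty_ger.
have n3 : 2 * (2 * kap + C) < kap * del * N%:R.
  rewrite [ltRHS]mulrC -ltr_pdivrMr ?mulr_gt0//; near: N; exact: nbhs_infty_gtr.
apply: (local_limit_fixed N m p) => //.
rewrite mulrAC ler_pdivlMr// -ler_pdivrMr//.
rewrite -[leLHS]ger0_norm; last first.
  by rewrite divr_ge0 ?(ltW cpi0)// mulr_ge0 ?(ltW skap0)//;
    move: C4_ge0 C5_ge0 C7_ge0; rewrite /C6; lra.
rewrite -sqrtr_sqr ler_wsqrtr//.
by near: N; exact: nbhs_infty_ger.
Unshelve. all: by end_near. Qed.

End LocalLimit.

(** * Expansion of the ratio of consecutive probabilities *)

(** The function v |-> ln (1 - exp (- v)): with q = exp (- g / N), it gives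
    ln (1 - q^j) at v = g j / N. *)
Definition ln1mexp {R : realType} (v : R) : R := ln (1 - expR (- v)).

(** The derivative of [ln1mexp]. *)
Definition dln1mexp {R : realType} (v : R) : R := expR (- v) / (1 - expR (- v)).

Section LogOneMinusExp.
Variable R : realType.
Implicit Types u v : R.


Lemma onem_expRN_gt0 v : 0 < v -> 0 < 1 - expR (- v).
Proof. by move=> v0; rewrite subr_gt0 expR_lt1 oppr_lt0. Qed.

(** [ln1mexp] is concave: its graph lies below its tangents. *)
Lemma ln1mexp_tangent u v : 0 < u -> 0 < v ->
  ln1mexp v - ln1mexp u <= dln1mexp u * (v - u).
Proof.
move=> u0 v0; have U := onem_expRN_gt0 _ u0; have V := onem_expRN_gt0 _ v0.
rewrite /ln1mexp /dln1mexp -ln_div ?posrE//.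
set r := _ / _; have r0 : 0 < r by rewrite divr_gt0.
have : ln r <= r - 1.
  rewrite -[X in ln X](subrK 1) addrC; apply: le_ln1Dx; lra.
move=> /le_trans; apply.
have -> : r - 1 = expR (- u) / (1 - expR (- u)) * (1 - expR (- (v - u))).
  have -> : expR (- (v - u)) = expR (- v) / expR (- u).
    by rewrite -expRN -expRD; congr expR; lra.
  by rewrite /r; field; rewrite !gt_eqF ?expR_gt0.
apply: ler_wpM2l; first by rewrite divr_ge0 ?expR_ge0 ?ltW.
have := expR_ge1Dx (- (v - u)); lra.
Qed.

Lemma expRN_lip u v : 0 <= u -> 0 <= v
  -> `|expR (- u) - expR (- v)| <= `|u - v|.
Proof.
wlog uv : u v / u <= v.
  move=> H u0 v0; have [uv|/ltW vu] := leP u v; first exact: H.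
  by rewrite distrC [leRHS]distrC; exact: H.
move=> u0 v0; rewrite ger0_norm; last by rewrite subr_ge0 ler_expR lerN2.
rewrite ler0_norm ?subr_le0// opprB.
have -> : expR (- v) = expR (- u) * expR (- (v - u)).
  by rewrite -expRD; congr expR; lra.
have := expR_ge1Dx (- (v - u)) => H.
have e1 : expR (- u) <= 1 by rewrite expR_le1 oppr_le0.
have e0 := expR_gt0 (- u).
apply: (@le_trans _ _ (expR (- u) * (v - u))).
  by rewrite -[X in X - _]mulr1 -mulrBr ler_pM2l//; lra.
by rewrite ler_piMl// subr_ge0.
Qed.

Lemma ln1mexp_taylor u v : 0 < u -> u / 2 <= v ->
  `|ln1mexp v - ln1mexp u - dln1mexp u * (v - u)|
    <= (1 - expR (- (u / 2))) ^- 2 * (v - u) ^+ 2.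
Proof.
move=> u0 uv; have u20 : 0 < u / 2 by lra.
have v0 : 0 < v by lra.
have U := onem_expRN_gt0 _ u0; have V := onem_expRN_gt0 _ v0.
have W := onem_expRN_gt0 _ u20.
have h1 := ln1mexp_tangent _ _ u0 v0; have h2 := ln1mexp_tangent _ _ v0 u0.
apply: (@le_trans _ _ ((dln1mexp u - dln1mexp v) * (v - u))).
  rewrite ler0_norm; last by rewrite subr_le0.
  by rewrite opprB mulrBl; lra.
apply: (le_trans (ler_norm _)); rewrite normrM.
rewrite -[in leRHS](real_normK (num_real (v - u))) [`|v - u| ^+ 2]expr2 mulrA.
apply: ler_wpM2r; first exact: normr_ge0.
have -> : dln1mexp u - dln1mexp v =
    (expR (- u) - expR (- v)) * ((1 - expR (- u))^-1 * (1 - expR (- v))^-1).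
  by rewrite /dln1mexp; field; rewrite !gt_eqF.
rewrite normrM [leRHS]mulrC; apply: ler_pM => //.
  by rewrite [`|v - u|]distrC expRN_lip// ltW.
rewrite ger0_norm; last by rewrite mulr_ge0// invr_ge0 ltW.
rewrite expr2 invfM; apply: ler_pM; rewrite ?invr_ge0 ?(ltW U) ?(ltW V)//.
  by rewrite lef_pV2 ?posrE// lerD2l lerN2 ler_expR; lra.
by rewrite lef_pV2 ?posrE// lerD2l lerN2 ler_expR; lra.
Qed.

(** First order expansion at v0 when the increment v - v0 is only known to be xi
    up to O(i). *)
Lemma ln1mexp_expand (v0 C0 : R) : 0 < v0 -> 0 <= C0 -> exists2 C, 0 <= C &
  forall v xi i : R, 0 <= i <= 1 -> v0 / 2 <= v -> `|v - v0 - xi| <= C0 * i ->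
  `|ln1mexp v - ln1mexp v0 - dln1mexp v0 * xi| <= C * (i + xi ^+ 2).
Proof.
move=> v00 C00; have v20 : 0 < v0 / 2 by lra.
have W := onem_expRN_gt0 _ v20; have U := onem_expRN_gt0 _ v00.
set M := (1 - expR (- (v0 / 2))) ^- 2.
have M0 : 0 <= M by rewrite invr_ge0 sqr_ge0.
have D0 : 0 <= dln1mexp v0 by rewrite divr_ge0 ?expR_ge0// ltW.
exists (2 * M + 2 * M * C0 ^+ 2 + dln1mexp v0 * C0).
  have h1 : 0 <= M * C0 ^+ 2 by rewrite mulr_ge0 ?sqr_ge0.
  have h2 : 0 <= dln1mexp v0 * C0 by rewrite mulr_ge0.
  by lra.
move=> v xi i /andP[i0 i1] vv H.
have T := ln1mexp_taylor _ _ v00 vv; rewrite -/M in T.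
set e := v - v0 - xi in H.
have -> : ln1mexp v - ln1mexp v0 - dln1mexp v0 * xi =
  (ln1mexp v - ln1mexp v0 - dln1mexp v0 * (v - v0)) + dln1mexp v0 * e.
  by rewrite /e; ring.
apply: (le_trans (ler_normD _ _)).
have e2 : e ^+ 2 <= C0 ^+ 2 * i.
  rewrite -real_normK ?num_real//.
  apply: (@le_trans _ _ ((C0 * i) ^+ 2)).
    by rewrite lerXn2r ?nnegrE// mulr_ge0.
  by rewrite exprMn ler_wpM2l ?sqr_ge0// expr2 ler_piMl.
have vE : (v - v0) ^+ 2 <= 2 * xi ^+ 2 + 2 * e ^+ 2.
  have := sqr_ge0 (xi - e).
  by rewrite (_ : v - v0 = xi + e) ?/e; [rewrite sqrrB sqrrD; lra|ring].
have h1 : M * (v - v0) ^+ 2 <= M * (2 * xi ^+ 2 + 2 * (C0 ^+ 2 * i)).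
  by rewrite ler_wpM2l//; lra.
have h2 : `|dln1mexp v0 * e| <= dln1mexp v0 * (C0 * i).
  by rewrite normrM (ger0_norm D0) ler_wpM2l.
have h3 : 0 <= (2 * M * C0 ^+ 2 + dln1mexp v0 * C0) * xi ^+ 2.
  have h3 : 0 <= M * C0 ^+ 2 by rewrite mulr_ge0 ?sqr_ge0.
  have h4 : 0 <= dln1mexp v0 * C0 by rewrite mulr_ge0.
  by apply: mulr_ge0; [lra|exact: sqr_ge0].
have h4 : 0 <= 2 * M * i by rewrite !mulr_ge0.
have -> : (2 * M + 2 * M * C0 ^+ 2 + dln1mexp v0 * C0) * (i + xi ^+ 2) =
  M * (2 * xi ^+ 2 + 2 * (C0 ^+ 2 * i)) + dln1mexp v0 * (C0 * i) + 2 * M * i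
  + (2 * M * C0 ^+ 2 + dln1mexp v0 * C0) * xi ^+ 2 by ring.
by lra.
Qed.

End LogOneMinusExp.

(** With a = exp (- beta x), b = exp (- beta y), c = exp (- beta) and
    z = exp (- beta h), the definition of h = hlim beta x y is the linear
    equation z (1 - c) = a + b - a b - c, equivalent to
    (z - a) (z - b) = (1 - z) (a b - c z). *)
Section LimitShapeTheory.
Variables (R : realType) (beta x y : R).
Hypotheses (beta0 : 0 < beta) (hx : 0 < x < 1) (hy : 0 < y < 1).
Local Notation h := (hlim beta x y).
Let a := expR (- beta * x).
Let b := expR (- beta * y).
Let c := expR (- beta).
Let z := expR (- beta * h).

Let ineqs : [/\ 0 < c, c < a, c < b, a < 1 & b < 1].
Proof.
move/andP: hx => [x0 x1]; move/andP: hy => [y0 y1].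
rewrite /a /b /c expR_gt0 !ltr_expR !expR_lt1 !mulNr !ltrN2 !oppr_lt0.
by rewrite !mulr_gt0//; split => //; rewrite gtr_pMr.
Qed.

Let bc0 : 0 < a + b - a * b - c.
Proof. by case: ineqs => ? ? ? ? ?; nra. Qed.

Let zE : z = (a + b - a * b - c) / (1 - c).
Proof.
case: ineqs => c0 ca cb a1 b1.
have -> : z = expR (ln (a + b - a * b - c) - ln (1 - c)).
  rewrite /z (_ : - beta * h = ln (a + b - a * b - c) - ln (1 - c))//.
  rewrite /hlim mulNr mulrA mulfV ?gt_eqF// mul1r opprB.
  by rewrite /a /b -expRD -mulrDr.
rewrite -ln_div ?posrE// ?lnK//; first by rewrite posrE divr_gt0//; lra.
by lra.
Qed.

Let zc : z * (1 - c) = a + b - a * b - c.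
Proof. by rewrite zE divfK// gt_eqF//; case: ineqs; lra. Qed.

(** The four entries of the limiting contingency table are positive. *)
Lemma hlim_bounds : [/\ 0 < h, h < x, h < y & x + y - 1 < h].
Proof.
case: ineqs => c0 ca cb a1 b1; have c1 : 0 < 1 - c by lra.
have H1 : z < 1 by rewrite zE ltr_pdivrMr//; nra.
have H2 : a < z by rewrite zE ltr_pdivlMr//; nra.
have H3 : b < z by rewrite zE ltr_pdivlMr//; nra.
have H4 : c * z < a * b by rewrite zE mulrA ltr_pdivrMr//; nra.
split.
- by move: H1; rewrite /z expR_lt1 mulNr oppr_lt0 pmulr_rgt0.
- by move: H2; rewrite ltr_expR !mulNr ltrN2 ltr_pM2l.
- by move: H3; rewrite ltr_expR !mulNr ltrN2 ltr_pM2l.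
- move: H4; rewrite -!expRD ltr_expR !mulNr -!opprD ltrN2 -mulrDr -[X in _ < X + _]mulr1.
  by rewrite -mulrDr ltr_pM2l//; lra.
Qed.

Let v1 := beta * (y - h).
Let v2 := beta * (x - h).
Let v3 := beta * h.
Let v4 := beta * (1 - x - y + h).

Lemma shape_args_gt0 : [/\ 0 < v1, 0 < v2, 0 < v3 & 0 < v4].
Proof. by case: hlim_bounds => *; split; apply: mulr_gt0 => //; lra. Qed.

Let E1 : expR (- v1) = b / z.
Proof. by rewrite /b /z -expRN -expRD; congr expR; rewrite /v1; ring. Qed.
Let E2 : expR (- v2) = a / z.
Proof. by rewrite /a /z -expRN -expRD; congr expR; rewrite /v2; ring. Qed.
Let E3 : expR (- v3) = z.
Proof. by rewrite /z mulNr. Qed.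
Let E4 : expR (- v4) = c * z / (a * b).
Proof. by rewrite /a /b /c /z -!expRD -expRN -expRD; congr expR; rewrite /v4;
  ring. Qed.

Let saddle : (z - a) * (z - b) = (1 - z) * (a * b - c * z).
Proof.
transitivity ((1 - z) * (a * b - c * z) + z * (z * (1 - c) - (a + b - a * b - c))).
  by ring.
by rewrite zc subrr mulr0 addr0.
Qed.

(** The limiting ratio of consecutive probabilities is one at h. *)
Lemma saddle_eq :
  v1 + v2 + ln1mexp v1 + ln1mexp v2 = ln1mexp v3 + ln1mexp v4.
Proof.
have [w1 w2 w3 w4] := shape_args_gt0.
have p1 := onem_expRN_gt0 _ _ w1; have p2 := onem_expRN_gt0 _ _ w2.
have p3 := onem_expRN_gt0 _ _ w3; have p4 := onem_expRN_gt0 _ _ w4.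
apply: expR_inj; rewrite /ln1mexp !expRD !lnK ?posrE//.
have F1 : expR v1 = (b / z)^-1 by rewrite -E1 expRN invrK.
have F2 : expR v2 = (a / z)^-1 by rewrite -E2 expRN invrK.
rewrite F1 F2 E1 E2 E3 E4.
have := saddle => H.
have a0 : a != 0 by rewrite gt_eqF// expR_gt0.
have b0 : b != 0 by rewrite gt_eqF// expR_gt0.
have z0 : z != 0 by rewrite gt_eqF// expR_gt0.
transitivity ((z - a) * (z - b) / (a * b)); first by field; rewrite a0 b0 z0.
by rewrite H; field; rewrite a0 b0.
Qed.

(** The right hand side is minus the logarithmic derivative of the limiting
    ratio of consecutive probabilities at h. *)
Lemma kappaE : beta * expR (dlim beta x y) ^+ 2 =
  beta * (2 + dln1mexp v1 + dln1mexp v2 + dln1mexp v3 + dln1mexp v4).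
Proof.
congr (_ * _); have [w1 w2 w3 w4] := shape_args_gt0.
have p1 := onem_expRN_gt0 _ _ w1; have p2 := onem_expRN_gt0 _ _ w2.
have p3 := onem_expRN_gt0 _ _ w3; have p4 := onem_expRN_gt0 _ _ w4.
have [c0 ca cb a1 b1] := ineqs.
have c1 : 0 < 1 - c by lra.
have -> : expR (dlim beta x y) ^+ 2 = (1 - c) / ((1 - expR (- v2)) * (1 - expR (- v1))).
  rewrite -expRM_natl -[RHS]lnK; last by rewrite posrE divr_gt0// mulr_gt0.
  congr expR; rewrite ln_div ?posrE ?mulr_gt0// lnM ?posrE//.
  by rewrite /dlim /v1 /v2 !mulNr; field.
rewrite /dln1mexp; move: p1 p2 p3 p4; rewrite E1 E2 E3 E4.
have a0 : a != 0 by rewrite gt_eqF// expR_gt0.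
have b0 : b != 0 by rewrite gt_eqF// expR_gt0.
have z0 : 0 < z by rewrite expR_gt0.
have ab0 : 0 < a * b by rewrite mulr_gt0// expR_gt0.
have z0' : z != 0 by rewrite gt_eqF.
rewrite !subr_gt0 !ltr_pdivrMr// !mul1r => bz az z1 cz.
have q1 : z - a != 0 by rewrite gt_eqF// subr_gt0.
have q2 : z - b != 0 by rewrite gt_eqF// subr_gt0.
have q3 : 1 - z != 0 by rewrite gt_eqF// subr_gt0.
have q4 : a * b - c * z != 0 by rewrite gt_eqF// subr_gt0.
transitivity ((1 - c) * z ^+ 2 / ((z - a) * (z - b))).
  by field; rewrite z0' q1 q2.
transitivity (z / (z - b) + z / (z - a) + (z * (a * b - c * z) + c * z * (1 - z)) / ((1 - z) * (a * b - c * z))); last first.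
  by field; rewrite q1 q2 q3 q4 z0' a0 b0.
rewrite -saddle.
transitivity (z * (2 * z - a - b + a * b + c - 2 * c * z) / ((z - a) * (z - b))); last first.
  by field; rewrite q1 q2.
transitivity (((1 - c) * z ^+ 2 + z * (z * (1 - c) - (a + b - a * b - c)))
  / ((z - a) * (z - b))); first by rewrite zc subrr mulr0 addr0.
by field; rewrite q1 q2.
Qed.

End LimitShapeTheory.

Lemma lnV_onem_le (R : realType) (t : R) : 0 <= t <= 2^-1 ->
  `|- ln (1 - t) - t| <= 2 * t ^+ 2.
Proof.
move=> /andP[t0 t2]; have t1 : 0 < 1 - t by lra.
have h1 : ln (1 - t) <= - t by apply: le_ln1Dx; lra.
have h2 : - ln (1 - t) <= t / (1 - t).
  rewrite -lnV ?posrE// [in leLHS](_ : (1 - t)^-1 = 1 + t / (1 - t));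
    last first.
    by field; rewrite gt_eqF.
  apply: le_ln1Dx; apply: (@lt_le_trans _ _ 0); first lra.
  by rewrite divr_ge0// ltW.
have h3 : t / (1 - t) <= t + 2 * t ^+ 2.
  by rewrite ler_pdivrMr//; have := sqr_ge0 t; nra.
rewrite ger0_norm; lra.
Qed.

Lemma norm_scale_le (R : realType) (g b w t A n : R) :
  0 < n -> 0 <= b -> 0 <= A <= 2 * n ->
  `|g * A / n - b * w - b * t| <= 2 * `|g - b| + b * (`|A - (w + t) * n| / n).
Proof.
move=> n0 b0 /andP[A0 An].
have -> : g * A / n - b * w - b * t = (g - b) * (A / n) + b * ((A - (w + t) * n) / n).
  by field; rewrite gt_eqF.
apply: (le_trans (ler_normD _ _)); apply: lerD.
  rewrite normrM mulrC ler_wpM2r// ger0_norm ?ler_pdivrMr//.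
  by rewrite divr_ge0// ltW.
by rewrite 2!normrM (ger0_norm b0) (gtr0_norm (_ : 0 < n^-1)) ?invr_gt0.
Qed.

(** Here g = - N ln q, which is beta + O(1/N) when q = 1 - beta / N. *)
Lemma height_law_ln_ratio (R : realType) (q : R) (q0 : 0 < q) (q1 : q < 1)
  (g : R) (N L K k : nat) : (0 < N)%N -> q = expR (- (g / N%:R)) ->
  (k < L)%N -> (k < K)%N -> (L <= N)%N -> (L + K <= N + k)%N ->
  ln (height_law q N L K k.+1) - ln (height_law q N L K k) =
  g * (K%:R - k%:R) / N%:R + g * (L%:R - k%:R) / N%:R - g / N%:R
  + ln1mexp (g * (K%:R - k%:R) / N%:R) + ln1mexp (g * (L%:R - k%:R) / N%:R)
  - ln1mexp (g * k.+1%:R / N%:R)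
  - ln1mexp (g * ((N + k).+1%:R - (L + K)%:R) / N%:R).
Proof.
move=> N0 qE kL kK LN LK.
have eE : ((L + K - k - k).-1.+1 = (K - k) + (L - k))%N by lia.
have n0 : N%:R != 0 :> R by rewrite pnatr_eq0 -lt0n.
have qX j : q ^+ j = expR (- (g * j%:R / N%:R)).
  by rewrite qE -expRM_natl; congr expR; field.
have qlt j : (0 < j)%N -> 0 < 1 - q ^+ j.
  by move=> j0; rewrite subr_gt0 exprn_ilt1 ?ltW// -lt0n.
have lnq j : ln (1 - q ^+ j) = ln1mexp (g * j%:R / N%:R) by rewrite qX.
have p1 : 0 < height_law q N L K k.+1 by apply: height_law_gt0 => //; lia.
have p0 : 0 < height_law q N L K k by apply: height_law_gt0 => //; lia.
have := height_law_ratio R q q0 q1 _ _ _ _ kL kK LN LK => /(congr1 (@ln R)).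
set e := (L + K - k - k).-1; set d := (N + k - L - K).+1.
have d0 : (0 < d)%N by [].
have a0 : (0 < K - k)%N by rewrite subn_gt0.
have b0 : (0 < L - k)%N by rewrite subn_gt0.
have x0 := exprn_gt0 e q0.
have y1 := qlt _ (ltn0Sn k); have y2 := qlt _ d0; have y3 := qlt _ a0;
  have y4 := qlt _ b0.
have y12 := mulr_gt0 y1 y2; have y12e := mulr_gt0 y12 x0;
  have y34 := mulr_gt0 y3 y4.
rewrite (lnM p1 y12e) (lnM y12 x0) (lnM y1 y2) (lnM p0 y34) (lnM y3 y4) !lnq.
rewrite {1}qX expRK.
rewrite -!natrB ?(ltnW kK) ?(ltnW kL)//; last by rewrite leqW.
rewrite (_ : (N + k).+1 - (L + K) = d)%N; last by rewrite subSn// subnDA.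
have -> : e%:R = (K - k)%:R + (L - k)%:R - 1 :> R.
  by rewrite -natrD -eE -natr1 addrK.
have -> : - (g * ((K - k)%:R + (L - k)%:R - 1) / N%:R) =
  - (g * (K - k)%:R / N%:R + g * (L - k)%:R / N%:R - g / N%:R).
  by field.
lra.
Qed.

(** The bookkeeping of error terms: V1, V2 are the perturbed arguments of the
    linear terms and L1, ..., L4 the perturbed values of [ln1mexp]. *)
Lemma expansion_error (R : realType) (beta C0 B1 B2 B3 B4 i t gi v1 v2 V1 V2
   l1 l2 l3 l4 L1 L2 L3 L4 d1 d2 d3 d4 : R) :
  0 <= beta -> 0 <= C0 -> 0 <= B1 -> 0 <= B2 -> 0 <= B3 -> 0 <= B4 -> 0 <= i ->
  `|V1 - v1 - beta * - t| <= C0 * i -> `|V2 - v2 - beta * - t| <= C0 * i ->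
  `|L1 - l1 - d1 * (beta * - t)| <= B1 * (i + beta ^+ 2 * t ^+ 2) ->
  `|L2 - l2 - d2 * (beta * - t)| <= B2 * (i + beta ^+ 2 * t ^+ 2) ->
  `|L3 - l3 - d3 * (beta * t)| <= B3 * (i + beta ^+ 2 * t ^+ 2) ->
  `|L4 - l4 - d4 * (beta * t)| <= B4 * (i + beta ^+ 2 * t ^+ 2) ->
  `|gi| <= (beta + C0) * i -> v1 + v2 + l1 + l2 = l3 + l4 ->
  `|V1 + V2 - gi + L1 + L2 - L3 - L4 + beta * (2 + d1 + d2 + d3 + d4) * t|
   <= ((B1 + B2 + B3 + B4) * (1 + beta ^+ 2) + 3 * C0 + beta) * (i + t ^+ 2).
Proof.
move=> b0 C00 B10 B20 B30 B40 i0 a1 a2 b1 b2 b3 b4 g0 sad.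
have t2 : 0 <= t ^+ 2 by exact: sqr_ge0.
have Bb : 0 <= beta ^+ 2 by exact: sqr_ge0.
have B0 : 0 <= B1 + B2 + B3 + B4 by rewrite !addr_ge0.
set B := B1 + B2 + B3 + B4 in B0 *.
have e1 : 0 <= (3 * C0 + beta + B) * t ^+ 2.
  by rewrite mulr_ge0// !addr_ge0// mulr_ge0.
have e2 : 0 <= B * beta ^+ 2 * i by rewrite !mulr_ge0.
have -> : (B * (1 + beta ^+ 2) + 3 * C0 + beta) * (i + t ^+ 2) =
  (beta + 3 * C0) * i + B * (i + beta ^+ 2 * t ^+ 2)
  + (3 * C0 + beta + B) * t ^+ 2 + B * beta ^+ 2 * i by ring.
have -> : V1 + V2 - gi + L1 + L2 - L3 - L4 + beta * (2 + d1 + d2 + d3 + d4) * t =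
  (V1 - v1 - beta * - t) + (V2 - v2 - beta * - t) - gi
  + (L1 - l1 - d1 * (beta * - t)) + (L2 - l2 - d2 * (beta * - t))
  - (L3 - l3 - d3 * (beta * t)) - (L4 - l4 - d4 * (beta * t))
  + ((v1 + v2 + l1 + l2) - (l3 + l4)) by ring.
rewrite sad subrr addr0.
apply: (@le_trans _ _ (C0 * i + C0 * i + (beta + C0) * i
  + B1 * (i + beta ^+ 2 * t ^+ 2) + B2 * (i + beta ^+ 2 * t ^+ 2)
  + B3 * (i + beta ^+ 2 * t ^+ 2) + B4 * (i + beta ^+ 2 * t ^+ 2))).
  do 6!(apply: (le_trans (ler_normD _ _)); rewrite ?normrN; apply: lerD => //).
by rewrite /B in e1 e2 *; clear -e1 e2; lra.
Qed.

(** The constant C is the same for all del up to zeta. *)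
Lemma height_law_expansion (R : realType) (beta x y : R) :
  0 < beta -> 0 < x < 1 -> 0 < y < 1 ->
  let h := hlim beta x y in
  exists C zeta : R, [/\ 0 <= C, 0 < zeta &
  forall del, 0 < del <= zeta -> \forall N \near \oo,
  let q := 1 - beta / N%:R in
  let L := Num.truncn (x * N%:R) in let K := Num.truncn (y * N%:R) in
  [/\ 0 < q, q < 1, (L <= N)%N, (K <= N)%N & del * N%:R + 2 <= h * N%:R] /\
  forall k : nat, `|k%:R - h * N%:R| <= del * N%:R ->
   [/\ (k < L)%N, (k < K)%N, (L + K <= N + k)%N &
  `|ln (height_law q N L K k.+1) - ln (height_law q N L K k)
    + beta * expR (dlim beta x y) ^+ 2 * (k%:R - h * N%:R) / N%:R|
  <= C * (N%:R^-1 + ((k%:R - h * N%:R) / N%:R) ^+ 2)]].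
Proof.
move=> beta0 hx hy h.
have [v10 v20 v30 v40] := shape_args_gt0 _ _ _ _ beta0 hx hy.
have [h0 hlx hly hxy] := hlim_bounds _ _ _ _ beta0 hx hy.
have sad := saddle_eq _ _ _ _ beta0 hx hy.
have kE := kappaE _ _ _ _ beta0 hx hy.
rewrite -/h in v10 v20 v30 v40 h0 hlx hly hxy sad kE.
set v1 := beta * (y - h) in v10 sad kE; set v2 := beta * (x - h) in v20 sad kE.
set v3 := beta * h in v30 sad kE;
  set v4 := beta * (1 - x - y + h) in v40 sad kE.
(* C0 / N bounds the error made in each argument of [ln1mexp] by taking
   q = 1 - beta / N instead of exp (- beta / N) and by rounding x N and y N. *)
pose C0 := 4 * beta ^+ 2 + 3 * beta.
have C00 : 0 <= C0 by rewrite addr_ge0 ?mulr_ge0 ?sqr_ge0// ltW.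
have [B1 B10 X1] := ln1mexp_expand _ _ _ v10 C00.
have [B2 B20 X2] := ln1mexp_expand _ _ _ v20 C00.
have [B3 B30 X3] := ln1mexp_expand _ _ _ v30 C00.
have [B4 B40 X4] := ln1mexp_expand _ _ _ v40 C00.
pose B := B1 + B2 + B3 + B4.
exists (B * (1 + beta ^+ 2) + 3 * C0 + beta).
(* Within zeta N of h N, each entry of the contingency table stays above three
   quarters of its limiting proportion, up to rounding. *)
have [zeta [zeta0 z1 z2 z3 z4]] : exists zeta, [/\ 0 < zeta, 4 * zeta <= y - h,
    4 * zeta <= x - h, 4 * zeta <= h & 4 * zeta <= 1 - x - y + h].
  exists (Num.min (Num.min (y - h) (x - h)) (Num.min h (1 - x - y + h)) / 4).
  set m := Num.min _ _; have -> : 4 * (m / 4) = m by lra.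
  split; rewrite ?ge_min ?lexx ?orbT//.
  by rewrite divr_gt0// !lt_min !subr_gt0 hlx hly h0 /=; lra.
exists zeta; split => //.
  have B0 : 0 <= B by rewrite !addr_ge0.
  have : 0 <= B * (1 + beta ^+ 2) by rewrite mulr_ge0// addr_ge0// sqr_ge0.
  by lra.
move=> del /andP[del0 delz]; near=> N.
set q := 1 - beta / N%:R; set L := Num.truncn (x * _);
  set K := Num.truncn (y * _).
have n1 : 1 <= N%:R :> R by near: N; exact: nbhs_infty_ger.
have n0 : 0 < N%:R :> R by exact: lt_le_trans n1.
have nb : 2 * beta <= N%:R by near: N; exact: nbhs_infty_ger.
have nz : 4 <= zeta * N%:R.
  by rewrite mulrC -ler_pdivrMr//; near: N; exact: nbhs_infty_ger.
have nC : C0 / N%:R <= beta * zeta.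
  rewrite ler_pdivrMr// mulrC -ler_pdivrMr ?mulr_gt0//.
  by near: N; exact: nbhs_infty_ger.
have nc : forall c : R, c * zeta * N%:R = c * (zeta * N%:R) by move=> c;
  rewrite mulrA.
have delN : del * N%:R <= zeta * N%:R by rewrite ler_pM2r.
have Y1 : 4 * (zeta * N%:R) <= y * N%:R - h * N%:R
  by rewrite -nc -mulrBl ler_pM2r.
have Y2 : 4 * (zeta * N%:R) <= x * N%:R - h * N%:R
  by rewrite -nc -mulrBl ler_pM2r.
have Y3 : 4 * (zeta * N%:R) <= h * N%:R by rewrite -nc ler_pM2r.
have Y4 : 4 * (zeta * N%:R) <= N%:R - x * N%:R - y * N%:R + h * N%:R.
  by rewrite -nc -{2}[N%:R]mul1r -!mulrBl -mulrDl ler_pM2r.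
have [/andP[x0 x1] /andP[y0 y1]] := (hx, hy).
have xN0 : 0 <= x * N%:R by rewrite mulr_ge0// ltW.
have yN0 : 0 <= y * N%:R by rewrite mulr_ge0// ltW.
have xN1 : x * N%:R <= N%:R by rewrite ger_pMl// ltW.
have yN1 : y * N%:R <= N%:R by rewrite ger_pMl// ltW.
have /andP[L1 L2] := truncn_itv xN0; have /andP[K1 K2] := truncn_itv yN0.
rewrite -/L -natr1 in L1 L2; rewrite -/K -natr1 in K1 K2.
have bN0 : 0 < beta / N%:R by rewrite divr_gt0.
have bN2 : beta / N%:R <= 2^-1 by rewrite ler_pdivrMr//; clear -nb; lra.
have q0 : 0 < q by rewrite /q; clear -bN2; lra.
have q1 : q < 1 by rewrite /q; clear -bN0; lra.
have LN : (L <= N)%N by rewrite -(ler_nat R) (le_trans L1).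
have KN : (K <= N)%N by rewrite -(ler_nat R) (le_trans K1).
split; first by split => //; clear -delN Y3 nz; lra.
move=> k; set u := k%:R - h * N%:R => uk.
have /andP[u1 u2] : - (zeta * N%:R) <= u <= zeta * N%:R.
  by rewrite -ler_norml; exact: le_trans delN.
have k0 : 0 <= k%:R :> R by [].
have kL : (k < L)%N by rewrite -(ltr_nat R); rewrite /u in u2;
  clear -u2 Y2 L2 nz; lra.
have kK : (k < K)%N by rewrite -(ltr_nat R); rewrite /u in u2;
  clear -u2 Y1 K2 nz; lra.
have LKk : (L + K <= N + k)%N.
  by rewrite -(ler_nat R) !natrD; rewrite /u in u1; clear -u1 Y4 L1 K1 nz; lra.
split => //.
pose g := - ln q * N%:R.
have qE : q = expR (- (g / N%:R)).
  by rewrite /g mulNr mulNr opprK mulfK ?gt_eqF// lnK.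
have gb : `|g - beta| <= 2 * beta ^+ 2 / N%:R.
  have := @lnV_onem_le _ (beta / N%:R); rewrite bN2 ltW// => /(_ isT).
  have -> : g - beta = (- ln q - beta / N%:R) * N%:R.
    by rewrite mulrBl divfK ?gt_eqF.
  rewrite normrM (gtr0_norm n0) -ler_pdivlMr// => /le_trans; apply.
  by rewrite le_eqVlt; apply/orP; left; apply/eqP; field; rewrite gt_eqF.
rewrite (height_law_ln_ratio _ _ q0 q1 g) //; last by rewrite -(ltr_nat R).
have i0 : 0 < N%:R^-1 :> R by rewrite invr_gt0.
have i1 : N%:R^-1 <= 1 :> R by rewrite invf_le1.
set i := N%:R^-1 in i0 i1 *; set t := u * i.
have iE : i * N%:R = 1 by rewrite mulVf ?gt_eqF.
have tN : t * N%:R = u by rewrite -mulrA iE mulr1.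
have tz : `|t| <= zeta
  by rewrite normrM (gtr0_norm i0) ler_pdivrMr// ler_norml u1.
have approx A w s : 0 <= A <= 2 * N%:R -> `|A - (w + s) * N%:R| <= 3 ->
    `|g * A * i - beta * w - beta * s| <= C0 * i.
  move=> hA hw; apply: (le_trans (norm_scale_le _ g beta w s A N%:R n0 (ltW beta0) hA)).
  have H : beta * (`|A - (w + s) * N%:R| * i) <= beta * (3 * i).
    by rewrite ler_pM2l// ler_pM2r.
  by rewrite -/i /C0; rewrite -/i in gb; clear -gb H; lra.
have low w s V : 4 * zeta <= w -> `|s| <= zeta
  -> `|V - beta * w - beta * s| <= C0 * i ->
    beta * w / 2 <= V.
  move=> hw; rewrite ler_norml => /andP[s1 _]; rewrite ler_norml => /andP[s2 _].
  have H1 : beta * (4 * zeta) <= beta * w by rewrite ler_pM2l.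
  have H2 : beta * - zeta <= beta * s by rewrite ler_pM2l.
  by rewrite -/i in nC; clear -nC H1 H2 s2; lra.
have ntz : `|- t| <= zeta by rewrite normrN.
set V1 := g * (K%:R - k%:R) * i; set V2 := g * (L%:R - k%:R) * i.
set V3 := g * k.+1%:R * i; set V4 := g * ((N + k).+1%:R - (L + K)%:R) * i.
have uE : k%:R = u + h * N%:R by rewrite /u subrK.
have Nk1 : (N + k).+1%:R = N%:R + k%:R + 1 :> R by rewrite -natr1 natrD.
have kk1 : k.+1%:R = k%:R + 1 :> R by rewrite -natr1.
have LKE : (L + K)%:R = L%:R + K%:R :> R by rewrite natrD.
have kKR : k%:R <= K%:R :> R by rewrite ler_nat ltnW.
have kLR : k%:R <= L%:R :> R by rewrite ler_nat ltnW.
have LNR : L%:R <= N%:R :> R by rewrite ler_nat.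
have KNR : K%:R <= N%:R :> R by rewrite ler_nat.
have LKkR : L%:R + K%:R <= N%:R + k%:R :> R by rewrite -!natrD ler_nat.
have a1 : `|V1 - v1 - beta * - t| <= C0 * i.
  apply: approx; first by clear -kKR KNR k0; apply/andP; split; lra.
  rewrite mulrDl mulrBl mulNr tN ler_norml.
  by clear -uE K1 K2; apply/andP; split; lra.
have a2 : `|V2 - v2 - beta * - t| <= C0 * i.
  apply: approx; first by clear -kLR LNR k0; apply/andP; split; lra.
  rewrite mulrDl mulrBl mulNr tN ler_norml.
  by clear -uE L1 L2; apply/andP; split; lra.
have a3 : `|V3 - v3 - beta * t| <= C0 * i.
  apply: approx; rewrite kk1.
    by clear -kKR KNR k0 n1; apply/andP; split; lra.
  by rewrite mulrDl tN ler_norml; clear -uE; apply/andP; split; lra.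
have a4 : `|V4 - v4 - beta * t| <= C0 * i.
  apply: approx; rewrite Nk1 LKE.
    by clear -kKR kLR LKkR KNR LNR k0 n1; apply/andP; split; lra.
  rewrite mulrDl [X in X + t * _]mulrDl 2!mulrBl mul1r tN ler_norml.
  by clear -uE K1 K2 L1 L2; apply/andP; split; lra.
have ii : 0 <= i <= 1 by rewrite i1 ltW.
have b1 := X1 _ _ _ ii (low _ _ _ z1 ntz a1) a1.
have b2 := X2 _ _ _ ii (low _ _ _ z2 ntz a2) a2.
have b3 := X3 _ _ _ ii (low _ _ _ z3 tz a3) a3.
have b4 := X4 _ _ _ ii (low _ _ _ z4 tz a4) a4.
rewrite kE -[_ * u / N%:R]mulrA -/i -/t.
rewrite [(beta * - t) ^+ 2]exprMn sqrrN in b1 b2.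
rewrite [(beta * t) ^+ 2]exprMn in b3 b4.
have gi : `|g * i| <= (beta + C0) * i.
  rewrite normrM (gtr0_norm i0) ler_pM2r//.
  have -> : g = beta + (g - beta) by ring.
  apply: (le_trans (ler_normD _ _)); rewrite (gtr0_norm beta0) lerD2l.
  apply: (le_trans gb); rewrite -/i /C0.
  have H : 2 * beta ^+ 2 * i <= 2 * beta ^+ 2 * 1.
    by rewrite ler_wpM2l// mulr_ge0 ?sqr_ge0.
  by have := sqr_ge0 beta; clear -H beta0; lra.
exact: (expansion_error _ _ _ _ _ _ _ _ _ _ _ _ _ _ _ _ _ _ _ _ _ _ _ _ _ _ (ltW beta0) C00 B10 B20 B30 B40
  (ltW i0) a1 a2 b1 b2 b3 b4 gi sad).
Unshelve. all: by end_near. Qed.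

(** * The local limit theorem for the height function *)

(** Finiteness of D is not needed: when F has infinitely many nonzero values on
    D, the big operator is empty and equal to 0. *)
Lemma norm_fsbig_max_le (R : realType) (I : choiceType) (D : set I) (F : I -> R)
  (b : R) : 0 <= b -> (forall i, D i -> 0 <= F i <= b) ->
  `|\big[Num.max/0]_(i \in D) F i| <= b.
Proof.
move=> b0 Fb.
suff /andP[m0 mb] : 0 <= \big[Num.max/0]_(i \in D) F i <= b
  by rewrite ger0_norm.
case: (pselect (finite_set (D `&` F @^-1` [set~ 0]))) => [fin|]; last first.
  move=> inf; rewrite (_ : finite_support _ _ _ = [::]) ?big_nil ?lexx//.
  exact: no_finite_support.
rewrite big_seq; elim/big_ind: _ => [|u v /andP[u0 ub] /andP[v0 vb]|i];
  first by rewrite lexx.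
  by rewrite le_max u0 ge_max ub vb.
by rewrite in_finite_support// in_setE => -[/Fb].
Qed.

Lemma sigmaE (R : realType) (N : nat) (beta x y : R) : 0 < beta ->
  sigma N beta x y =
  Num.sqrt N%:R / Num.sqrt (beta * expR (dlim beta x y) ^+ 2).
Proof.
by move=> b0; rewrite /sigma sqrtrM ?(ltW b0)// sqrtr_sqr ger0_norm ?expR_ge0.
Qed.

Lemma powR6_cube (R : realType) (a : R) : 0 <= a -> a `^ 6^-1 ^+ 3 = Num.sqrt a.
Proof.
move=> a0; rewrite -powR_mulrn ?powR_ge0// -powRrM -powR12_sqrt//.
by congr (_ `^ _); lra.
Qed.

Lemma near_cube_le_sqrt (R : realType) (A : nat -> R) :
  (fun N : nat => A N / (N%:R : R) `^ (6^-1)) @ \oo --> (0 : R) ->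
  \forall N \near \oo, 0 <= A N -> A N ^+ 3 <= Num.sqrt N%:R.
Proof.
move=> hA; near=> N => A0.
have N0 : 0 < N%:R :> R by rewrite ltr0n; near: N; exact: nbhs_infty_gt.
have pN : 0 < (N%:R : R) `^ 6^-1 by rewrite powR_gt0.
have : `|A N / (N%:R : R) `^ 6^-1| < 1.
  by near: N; exact: (@cvgr0_norm_lt _ _ _ _ _ _ hA).
rewrite ger0_norm; last by rewrite divr_ge0// ltW.
rewrite ltr_pdivrMr// mul1r => A1.
apply: (@le_trans _ _ ((N%:R : R) `^ 6^-1 ^+ 3)).
  by rewrite lerXn2r ?nnegrE ?powR_ge0 ?(ltW A1).
by rewrite powR6_cube.
Unshelve. all: by end_near. Qed.

Lemma le_sqrt_of_cube_le (R : realType) (A S del : R) : 0 < S -> 0 < del ->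
  (del ^+ 3)^-1 <= S ^+ 2 -> A ^+ 3 <= S -> A <= del * S.
Proof.
move=> S0 d0 dS AS; rewrite leNgt; apply/negP => H.
have d3 : 0 < del ^+ 3 by rewrite exprn_gt0.
have H1 : 1 * S <= del ^+ 3 * S ^+ 2 * S.
  by rewrite ler_pM2r// -ler_pdivrMl// mulr1.
have H2 : del ^+ 3 * S ^+ 2 * S < A ^+ 3.
  by rewrite -mulrA -exprSr -exprMn ltrXn2r// ltW// mulr_gt0.
by rewrite mul1r in H1; clear -H1 H2 AS; lra.
Qed.

Theorem theorem4p11 (R : realType) (beta : R) (hbeta : 0 < beta)
  (A : nat -> R)
  (hmono : {homo A : m n / (m <= n)%N >-> m <= n})
  (hA : (fun N : nat => A N / (N%:R : R) `^ (6^-1)) @ \oo --> (0 : R))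
  (x y : R) (hx : 0 < x < 1) (hy : 0 < y < 1) :
  (fun N : nat =>
     \big[Num.max/0]_(k \in window (hlim beta x y * N%:R)
                                   (Num.sqrt N%:R * A N))
        `|sigma N beta x y
          * mallows (1 - beta / N%:R)
              [set w : 'S_N | (height (Num.truncn (x * N%:R))
                                      (Num.truncn (y * N%:R)) w)%:Z == k]%SET
          / normal_pdf 0 1 ((k%:~R - hlim beta x y * N%:R) / sigma N beta x y)
          - 1|)
  =O_\oo (fun N : nat => A N ^+ 3 / Num.sqrt (N%:R : R)).
Proof.
apply/eqO_exP.
have [Apos|Aneg] := pselect (exists N0, 0 < A N0); last first.
  exists 1 => //; apply: nearW => N.
  rewrite (le_trans (norm_fsbig_max_le _ _ _ _ 0 _ _))// ?mul1r// => k.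
  rewrite /window /= => Hk; exfalso; apply: Aneg; exists N.
  rewrite ltNge; apply/negP => AN.
  have : 0 < Num.sqrt N%:R * A N by apply: le_lt_trans Hk.
  by rewrite ltNge mulr_ge0_le0.
have [N0 AN0] := Apos.
set a := A N0 in AN0.
have [C [zeta [C0 zeta0 HC]]] := height_law_expansion _ _ _ _ hbeta hx hy.
set h := hlim beta x y in HC *.
set kap := beta * expR (dlim beta x y) ^+ 2 in HC.
have kap0 : 0 < kap by rewrite mulr_gt0// exprn_gt0// expR_gt0.
have Ck0 : 0 < 32 * (C + kap) by rewrite mulr_gt0// ltr_wpDl.
pose del := Num.min zeta (kap / (32 * (C + kap))).
have del0 : 0 < del by rewrite lt_min zeta0 divr_gt0.
have delz : del <= zeta by rewrite ge_min lexx.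
have dels : 32 * (C + kap) * del <= kap.
  by rewrite mulrC -ler_pdivlMr// ge_min lexx orbT.
have {}HC := HC del; rewrite del0 delz in HC; have {}HC := HC isT.
(* On the window w < A N and a <= A N, so that (1 + w)^3 <= M (A N)^3. *)
pose M := (a^-1 + 1) ^+ 3.
have [D HD] := local_limit _ _ _ _ kap0 C0 del0 dels M.
have M0 : 0 < M by rewrite exprn_gt0// addr_gt0// invr_gt0.
have [N1 _ {}HC] := HC; have [N2 _ {}HD] := HD.
exists ((`|D| + 1) * M); first by rewrite mulr_gt0// ltr_wpDl.
near=> N.
have Npos : (0 < N)%N by near: N; exact: nbhs_infty_gt.
have n0 : 0 < N%:R :> R by rewrite ltr0n.
have S0 : 0 < Num.sqrt N%:R :> R by rewrite sqrtr_gt0.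
have SE : Num.sqrt N%:R ^+ 2 = N%:R :> R by rewrite sqr_sqrtr// ltW.
have aA : a <= A N by apply: hmono; near: N; exact: nbhs_infty_ge.
have A0 : 0 < A N by apply: lt_le_trans aA.
have A3 : A N ^+ 3 <= Num.sqrt N%:R.
  by move: (ltW A0); near: N; exact: near_cube_le_sqrt.
have Adel : A N <= del * Num.sqrt N%:R.
  apply: le_sqrt_of_cube_le => //; rewrite SE.
  by near: N; exact: nbhs_infty_ger.
have N1N : (N1 <= N)%N by near: N; exact: nbhs_infty_ge.
have N2N : (N2 <= N)%N by near: N; exact: nbhs_infty_ge.
have [[q0 q1 LN KN m_ge] ratio] := HC N N1N.
have {}HD := HD N N2N.
set q := 1 - beta / N%:R in q0 q1 ratio *.
set L := Num.truncn (x * _) in LN ratio *.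
set K := Num.truncn (y * _) in KN ratio *.
have bd0 : 0 <= (`|D| + 1) * M * `|A N ^+ 3 / Num.sqrt N%:R|.
  by rewrite mulr_ge0// mulr_ge0 ?(ltW M0)// addr_ge0.
apply: norm_fsbig_max_le => // k; rewrite /window /= normr_ge0 /= => Hk.
have Hk' : `|k%:~R - h * N%:R| <= del * N%:R.
  apply: (le_trans (ltW Hk)); rewrite -[in leRHS]SE expr2 mulrA mulrC.
  by rewrite ler_pM2r.
have kpos : 0 < k%:~R :> R.
  by move: Hk'; rewrite ler_norml => /andP[Hk1 _]; clear -Hk1 m_ge; lra.
case: k kpos Hk Hk' => [k|k]; last first.
  by rewrite ltr0z.
move=> _; rewrite -pmulrn => Hk Hk'.
rewrite (mallows_height _ _ _ _ _ k).
rewrite sigmaE// -/kap.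
have w0 : 0 <= `|k%:R - h * N%:R| / Num.sqrt N%:R by rewrite divr_ge0 ?(ltW S0).
have wA : `|k%:R - h * N%:R| / Num.sqrt N%:R <= A N.
  by rewrite ler_pdivrMr// [leRHS]mulrC ltW.
have cube : (1 + `|k%:R - h * N%:R| / Num.sqrt N%:R) ^+ 3 <= M * A N ^+ 3.
  have w1 := addr_ge0 ler01 w0.
  have aA1 : 0 <= (a^-1 + 1) * A N.
    by rewrite mulr_ge0 ?(ltW A0)// addr_ge0// invr_ge0 ltW.
  rewrite /M -exprMn lerXn2r ?nnegrE//.
  rewrite mulrDl mul1r; apply: lerD => //.
  by rewrite mulrC ler_pdivlMr// mul1r.
apply: (@le_trans _ _ (D * (1 + `|k%:R - h * N%:R| / Num.sqrt N%:R) ^+ 3 / Num.sqrt N%:R)).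
  apply: (HD (h * N%:R) (height_law q N L K)) => //.
  - by move=> j; exact: height_law_ge0.
  - move=> j Nj; apply: height_law_eq0 => //.
    by rewrite (leq_ltn_trans LN).
  - exact: sum_height_law.
  - move=> j /ratio[jL jK LKj _]; apply: height_law_gt0 => //; exact: ltnW.
  - by move=> j /ratio[].
  - by move=> i j; exact: height_law_unimodal.
  - apply: (le_trans cube); rewrite ler_pM2l//.
have AS0 : 0 <= A N ^+ 3 / Num.sqrt N%:R.
  by rewrite divr_ge0 ?exprn_ge0 ?(ltW A0).
rewrite (ger0_norm AS0) [leRHS]mulrA ler_pM2r ?invr_gt0// -[leRHS]mulrA.
apply: (@le_trans _ _ ((`|D| + 1) * (1 + `|k%:R - h * N%:R| / Num.sqrt N%:R) ^+ 3)).
  rewrite ler_wpM2r ?exprn_ge0 ?addr_ge0//.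
  by apply: (le_trans (ler_norm D)); rewrite lerDl.
by rewrite ler_pM2l// ltr_wpDl.
Unshelve. all: by end_near. Qed.
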